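(* Let $q>1$ and let $m_1<m_2<\cdots$ be positive integers with $\frac{m_{k+1}}{m_k}\ge q$ for all $k\in\mathbb{N}$. Let $(a_{k,n})_{1\le k\le n}$ be a triangular array of real numbers, and put $$S_n^{\mathrm T}(x)=\sum_{k=1}^n a_{k,n}\cos(2\pi m_k x),\quad 0\le x\le 1,\qquad A_n=\Big(\tfrac12\sum_{k=1}^n a_{k,n}^2\Big)^{1/2},\qquad d_n=\max_{1\le k\le n}|a_{k,n}|.$$ Suppose $A_n\to\infty$ as $n\to\infty$, and suppose that there exists $\varepsilon>0$ such that, as $n\to\infty$, - if $1<q\le 2$: $n^{1+\varepsilon}d_n^3\to 0$; - if $q>2$: $n^{1+\varepsilon}d_n^4\to 0$. Then the sequence $(S_n^{\mathrm T})_{n\in\mathbb{N}}$, regarded as random variables on $[0,1]$ with Lebesgue measure, converges mod-Gaussian in the weak sense (defined in the context) with the sequence $(A_n)$.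
   Context: Weak mod-Gaussian convergence: let $(X_n)$ be real-valued random variables and write $\varphi_n(i\lambda)=\mathbb{E}[e^{i\lambda X_n}]$ for $\lambda\in\mathbb{R}$. One says that $(X_n)$ converges mod-Gaussian in the weak sense, with a sequence $A_n\to\infty$, if: (1) for every $\lambda\in\mathbb{R}$, $\varphi_n\big(\tfrac{i\lambda}{A_n}\big)\to e^{-\lambda^2/2}$ as $n\to\infty$; (2) for every $K\ge 0$, the sequence of functions $\lambda\mapsto\varphi_n\big(\tfrac{i\lambda}{A_n}\big)\mathbf 1_{\{|\lambda|\le A_nK\}}$ is uniformly integrable on $\mathbb{R}$ with respect to Lebesgue measure (for these functions, which are bounded by $1$, this means $\lim_{a\to\infty}\sup_n\int_{|\lambda|\ge a}\big|\varphi_n(\tfrac{i\lambda}{A_n})\big|\mathbf 1_{\{|\lambda|\le A_nK\}}\,d\lambda=0$). *)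

(* Defs.v *)
From HB Require Import structures.
From mathcomp Require Import all_boot all_order all_algebra.
From mathcomp Require Import complex.
From mathcomp Require Import all_classical all_reals all_analysis.
From mathcomp Require Import measurable_realfun.

Set Implicit Arguments.
Unset Strict Implicit.
Unset Printing Implicit Defensive.

Import Order.TTheory GRing.Theory Num.Theory.
Import numFieldNormedType.Exports.

Local Open Scope classical_set_scope.
Local Open Scope ring_scope.

(* E[e^{i l X}], through e^{iy} = cos y + i sin y. Both expectations are
   finite, so `fine` loses nothing. This is the value written phi(i l) when
   phi(z) = E[e^{zX}]. *)
Definition char_fun (R : realType) d (T : measurableType d)
    (P : probability T R) (X : {RV P >-> R}) (l : R) : R[i] :=
  Complex (fine 'E_P[fun w => cos (l * X w)]%E)
          (fine 'E_P[fun w => sin (l * X w)]%E).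

(* Uniform integrability on the real line is taken in its tail form, which is
   the meaningful condition for functions bounded by 1, as here. Where A n = 0
   (possible for finitely many n only), l / A n is 0 and the indicator is that
   of a Lebesgue-null set. *)
Definition weak_mod_gaussian (R : realType) d (T : measurableType d)
    (P : probability T R) (X : nat -> {RV P >-> R}) (A : nat -> R) : Prop :=
  [/\ A n @[n --> \oo] --> +oo,
      forall l : R,
        char_fun (X n) (l / A n) @[n --> \oo]
          --> (Complex (expR (- (l ^+ 2 / 2))) 0 : R[i]^o)
    & forall K : R, 0 <= K ->
        ereal_sup (range (fun n : nat =>
          (\int[@lebesgue_measure R]_(l in [set l : R | (a <= `|l|)%R])
             (ComplexField.Normc.normc (char_fun (X n) (l / A n))
              * \1_[set l : R | `|l| <= A n * K] l)%:E)%E))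
          @[a --> +oo] --> 0%E ].

Definition unit_lebesgue (R : realType) : set (measurableTypeR R) -> \bar R :=
  mrestr (@lebesgue_measure R) (measurable_itv `[0%R, 1%R]).

HB.instance Definition _ (R : realType) :=
  Measure.copy (@unit_lebesgue R)
    (mrestr (@lebesgue_measure R) (measurable_itv `[0%R, 1%R])).

Lemma unit_lebesgue_setT (R : realType) : unit_lebesgue [set: R] = 1%E.
Proof.
by rewrite /unit_lebesgue /mrestr setTI lebesgue_measure_itv /= lte_fin ltr01
   -EFinB subr0.
Qed.

HB.instance Definition _ (R : realType) :=
  Measure_isProbability.Build _ _ R (@unit_lebesgue R)
    (@unit_lebesgue_setT R).

(* Only the values m k for 1 <= k and a k n for 1 <= k <= n are used below. *)
Definition trig_sum (R : realType) (m : nat -> nat) (a : nat -> nat -> R)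
    (n : nat) (x : measurableTypeR R) : R :=
  \sum_(1 <= k < n.+1) a k n * cos (2 * pi * (m k)%:R * x).

Lemma measurable_trig_sum (R : realType) m (a : nat -> nat -> R) n :
  measurable_fun [set: measurableTypeR R] (trig_sum m a n).
Proof.
apply: measurable_sum => k.
apply: measurable_funM; first exact: measurable_cst.
apply: measurableT_comp; last exact: mulrl_measurable.
by apply: continuous_measurable_fun; exact: continuous_cos.
Qed.

HB.instance Definition _ (R : realType) m (a : nat -> nat -> R) n :=
  isMeasurableFun.Build _ _ _ _ (trig_sum m a n)
    (measurable_trig_sum m a n).

Definition trig_var (R : realType) (m : nat -> nat) (a : nat -> nat -> R)
    (n : nat) : {RV (@unit_lebesgue R) >-> R} := trig_sum m a n.

Definition norm_seq (R : realType) (a : nat -> nat -> R) (n : nat) : R :=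
  Num.sqrt (2^-1 * \sum_(1 <= k < n.+1) a k n ^+ 2).

Definition max_coef (R : realType) (a : nat -> nat -> R) (n : nat) : R :=
  \big[Num.max/0]_(1 <= k < n.+1) `|a k n|.

(* Main.v *)
Require Import Defs.
From mathcomp Require Import all_boot all_order all_algebra.
From mathcomp Require Import complex.
From mathcomp Require Import all_classical all_reals all_analysis.
From mathcomp Require Import measurable_realfun.
From mathcomp Require Import ring lra.
Import Order.TTheory GRing.Theory Num.Theory.
Import numFieldNormedType.Exports.
Local Open Scope classical_set_scope.
Local Open Scope ring_scope.

(** Write [S_k] for the sum of the first [k] terms of the [n]-th row and let
[|t| <= K].  The theorem follows from the comparison
  [E exp(i t S_n) = \prod_k (1 - (t a_k)^2 / 4) + O(sqrt n * eta)],
where [sqrt n * A_n * eta -> 0] uniformly in [t].  The product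
is at most [exp(- t^2 A_n^2 / 2)] and close to it as soon as [n d_n^4] is small.
At [t = l / A_n] this gives the central limit statement, and integrating over
[|l| <= A_n K] turns the error into [O(K A_n sqrt n * eta)], which tends to [0],
while the main term has the Gaussian tail.

The comparison is obtained by removing the terms from the highest frequency
down.  Taylor expansion of the [k]-th exponential leaves the factor
[1 - (t a_k)^2 / 4], the mean part of its quadratic term, together with means
of [cos(2 pi N x) * exp(i t S_(k-1))] for [N] in [{m_k, 2 m_k, 3 m_k}], each
with a coefficient of size [|t a_k|] ([mean_cos_step]).  Such a mean is small
([mean_harm_lacunary_le]).  Split [S_(k-1) = V + W], where [W] collects the
last [L] terms, and expand [exp(i t W)] up to order [p].  A monomial in [W] of
degree [j < p] shifts [N] by at most [j m_(k-1)], and [N] stays of order [m_k]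
because [p - 1 < q].  The result oscillates much faster than [exp(i t V)], so
its mean is [O(q^-L)] by integration by parts.  The Taylor remainder is
[(|t| L d_n)^p].  One takes [p = 2] for [1 < q <= 2] and [p = 3] for [2 < q].

Each step thus replaces an error [x] by [(1 - u^2 / 4) x + u * eta] with
[u = |t a_k|].  The increment is at most [eta^2 / x], because the contraction
absorbs large [u]; hence the total is [2 sqrt n * eta] and not
[n d_n * eta] ([contraction_sqrt_le]).  Since [A_n <= sqrt n * d_n], what is
needed is [n d_n * eta -> 0].  With [L] of order [log n] one has
[q^-L <= 1 / n], and the factor [n^eps] of the hypothesis pays for the powers
of [L] ([log_window], [osc_remainder_cvg]).

Complex exponentials are avoided by carrying an arbitrary phase [c] in
[cos(t S + c)]: [c = 0] and [c = - pi / 2] give the real and the imaginary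
part. *)

(** * Mean over the unit interval *)

Definition mean {R : realType} (f : R -> R) : R :=
  (\int[@lebesgue_measure R]_(x in `[0, 1]) f x)%R.

Lemma continuous_integrable01 {R : realType} (f : R -> R) :
  continuous f -> (@lebesgue_measure R).-integrable `[0, 1] (EFin \o f).
Proof.
move=> cf; apply: continuous_compact_integrable; first exact: segment_compact.
exact: continuous_subspaceT.
Qed.

Lemma eq_mean {R : realType} (f g : R -> R) : f =1 g -> mean f = mean g.
Proof. by move=> /funext ->. Qed.

Lemma meanD {R : realType} (f g : R -> R) : continuous f -> continuous g ->
  mean (fun x => f x + g x) = mean f + mean g.
Proof.
by move=> cf cg; rewrite /mean RintegralD//; exact: continuous_integrable01.
Qed.

Lemma meanZ {R : realType} (c : R) (f : R -> R) : continuous f ->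
  mean (fun x => c * f x) = c * mean f.
Proof.
by move=> cf; rewrite /mean RintegralZl//; exact: continuous_integrable01.
Qed.

Lemma mean_cst {R : realType} (c : R) : mean (fun=> c) = c.
Proof.
by rewrite /mean Rintegral_cst//= lebesgue_measure_itv/= lte_fin ltr01
  -EFinB subr0/= mulr1.
Qed.

Lemma continuous_sumr {R : realType} (I : Type) (r : seq I) (f : I -> R -> R) :
  (forall i, continuous (f i)) -> continuous (fun x => \sum_(i <- r) f i x).
Proof.
move=> cf; elim: r => [|i r IH].
  by under eq_fun do rewrite big_nil; move=> x; exact: cvg_cst.
under eq_fun do rewrite big_cons.
by move=> x; apply: cvgD; [exact: cf|exact: IH].
Qed.

Lemma mean_sum {R : realType} (I : Type) (r : seq I) (f : I -> R -> R) :
  (forall i, continuous (f i)) ->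
  mean (fun x => \sum_(i <- r) f i x) = \sum_(i <- r) mean (f i).
Proof.
move=> cf; elim: r => [|i r IH].
  by rewrite big_nil; under eq_mean do rewrite big_nil; exact: mean_cst.
rewrite big_cons -IH -meanD//; last exact: continuous_sumr.
by apply: eq_mean => x; rewrite big_cons.
Qed.

Lemma normr_mean_le {R : realType} (c : R) (f : R -> R) : continuous f ->
  (forall x, `|f x| <= c) -> `|mean f| <= c.
Proof.
move=> cf fc; apply: le_trans.
  by apply: le_normr_Rintegral => //; exact: continuous_integrable01.
rewrite -[leRHS](mean_cst c); apply: le_Rintegral => //.
- by apply: continuous_integrable01 => x; apply: cvg_norm; exact: cf.
- by apply: continuous_integrable01 => x; exact: cvg_cst.
Qed.

Lemma is_derive_continuous {R : realType} {f df : R -> R} :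
  (forall x : R, is_derive x 1 f (df x)) -> continuous f.
Proof.
by move=> fd x; apply/differentiable_continuous/derivable1_diffP; case: (fd x).
Qed.

Lemma mean_derive {R : realType} {F f : R -> R} :
  (forall x : R, is_derive x 1 F (f x)) -> continuous f ->
  mean f = F 1 - F 0.
Proof.
move=> dF cf; have cF := is_derive_continuous dF.
rewrite /mean /Rintegral (continuous_FTC2 (F := F) ltr01)//=.
- exact: continuous_subspaceT.
- split.
  + by move=> x _; case: (dF x).
  + exact: cvg_at_right_filter (cF 0).
  + exact: cvg_at_left_filter (cF 1).
- by move=> x _; rewrite derive1E; case: (dF x).
Qed.

(** * Oscillation of a harmonic *)

Definition harm {R : realType} (N : nat) (x : R) : R := cos (2 * pi * N%:R * x).

Lemma continuous_harm {R : realType} N : continuous (@harm R N).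
Proof.
move=> x; apply: continuous_comp; last exact: continuous_cos.
by apply: cvgM; [exact: cvg_cst|exact: cvg_id].
Qed.

Lemma is_derive_harm {R : realType} N (x : R) :
  is_derive x 1 (harm N) (- (2 * pi * N%:R * sin (2 * pi * N%:R * x))).
Proof.
have -> : harm N = cos \o (fun x : R => (2 * pi * N%:R) * x) by [].
apply: is_derive_eq.
by rewrite /GRing.scale/= mulr1; ring.
Qed.

Lemma sin_harm1 {R : realType} N : sin (2 * pi * N%:R) = 0 :> R.
Proof.
elim: N => [|N IH]; first by rewrite mulr0 sin0.
rewrite -[RHS]IH -[RHS]sinD2pi; congr sin; rewrite -natr1; ring.
Qed.

Lemma harmM {R : realType} (M N : nat) (x : R) : (N <= M)%N ->
  harm M x * harm N x = 2^-1 * (harm (M + N) x + harm (M - N) x).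
Proof.
move=> NM; rewrite /harm natrD natrB//.
have -> : 2 * pi * (M%:R + N%:R) * x = 2 * pi * M%:R * x + 2 * pi * N%:R * x :> R.
  by ring.
have -> : 2 * pi * (M%:R - N%:R) * x = 2 * pi * M%:R * x - 2 * pi * N%:R * x :> R.
  by ring.
by rewrite cosD cosB; field.
Qed.

Lemma normr_cos_le1 {R : realType} (x : R) : `|cos x| <= 1.
Proof. by rewrite ler_norml cos_geN1 cos_le1. Qed.

Lemma normr_sin_le1 {R : realType} (x : R) : `|sin x| <= 1.
Proof. by rewrite ler_norml sin_geN1 sin_le1. Qed.

(** Integration by parts; there is no boundary term, because the primitive
[sin(2 pi N x)] of the harmonic vanishes at both ends of the interval. *)
Lemma mean_harmM_le {R : realType} (N : nat) (D : R) (g dg : R -> R) :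
  (0 < N)%N -> (forall x : R, is_derive x 1 g (dg x)) -> continuous dg ->
  (forall x, `|dg x| <= 2 * pi * D) ->
  `|mean (fun x => harm N x * g x)| <= D / N%:R.
Proof.
move=> N0 gd cdg dgD.
have cg := is_derive_continuous gd.
have N0R : 0 < N%:R :> R by rewrite ltr0n.
have pi0 := pi_gt0 R.
pose w : R := 2 * pi * N%:R.
have w0 : 0 < w by rewrite /w !mulr_gt0.
pose s x := sin (w * x).
have ds (x : R) : is_derive x 1 s (w * harm N x).
  have -> : s = sin \o (fun x : R => w * x) by [].
  apply: is_derive_eq; rewrite /GRing.scale/= mulr1 mulrC; congr (_ * _).
have cs := is_derive_continuous ds.
have ch := @continuous_harm R N.
have chg : continuous (fun x => harm N x * g x).
  by move=> x; apply: cvgM; [exact: ch|exact: cg].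
have csd : continuous (fun x => s x * dg x).
  by move=> x; apply: cvgM; [exact: cs|exact: cdg].
have H : mean (fun x => w * (harm N x * g x) + s x * dg x) = 0.
  have dsg (x : R) :
      is_derive x 1 (s * g) (w * (harm N x * g x) + s x * dg x).
    have H := is_deriveM (ds x) (gd x).
    by apply: (is_derive_eq H); rewrite /GRing.scale/=; ring.
  rewrite (mean_derive dsg); last first.
    by move=> x; apply: cvgD; [apply: cvgM; [exact: cvg_cst|exact: chg]|exact: csd].
  rewrite -[LHS]/(s 1 * g 1 - s 0 * g 0) /s mulr1 mulr0 sin0 /w sin_harm1 !mul0r.
  by rewrite subrr.
move: H; rewrite meanD//; last by move=> x; apply: cvgM; [exact: cvg_cst|exact: chg].
rewrite meanZ// => /eqP; rewrite addr_eq0 => /eqP H.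
have H2 : w * `|mean (fun x => harm N x * g x)| <= 2 * pi * D.
  rewrite -(gtr0_norm w0) -normrM H normrN; apply: normr_mean_le => // x.
  rewrite normrM -[leRHS]mul1r; apply: ler_pM => //; exact: normr_sin_le1.
rewrite ler_pdivlMr// mulrC -(ler_pM2l (_ : 0 < 2 * pi)) ?mulr_gt0//.
by rewrite mulrA.
Qed.

(** * Taylor expansion of the cosine *)

Definition cos_taylor {R : realType} (p : nat) (y w : R) : R :=
  \sum_(j < p) w ^+ j / j`!%:R * cos (y + j%:R * (pi / 2)).

Lemma is_derive_cos_taylor {R : realType} p (y w : R) :
  is_derive w 1 (cos_taylor p.+1 y) (cos_taylor p (y + pi / 2) w).
Proof.
elim: p => [|p IH].
  have -> : cos_taylor 1 y = cst (cos y).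
    by apply/funext => x; rewrite /cos_taylor big_ord1 expr0 mul0r addr0 fact0
       divr1 mul1r.
  by rewrite /cos_taylor big_ord0; exact: is_derive_cst.
pose c : R := p.+1`!%:R^-1 * cos (y + p.+1%:R * (pi / 2)).
have -> : cos_taylor p.+2 y = cos_taylor p.+1 y + c \*: (id ^+ p.+1).
  apply/funext => x; rewrite /cos_taylor big_ord_recr/=; congr (_ + _).
  rewrite -[RHS]/(c * (id ^+ p.+1) x) /c exprfctE. ring.
apply: is_derive_eq; rewrite /cos_taylor [RHS]big_ord_recr/=; congr (_ + _).
rewrite /GRing.scale/= /c mulr1 factS natrM.
have -> : y + p.+1%:R * (pi / 2) = y + pi / 2 + p%:R * (pi / 2).
  by rewrite -natr1; ring.
by rewrite -natr1; field; rewrite natr1 !pnatr_eq0 -lt0n fact_gt0.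
Qed.

(** The derivative in [w] of the remainder of order [p + 1] is the remainder of
order [p] with the phase advanced by [pi / 2], so the mean value theorem gives
the bound by induction. *)
Lemma cos_taylor_le {R : realType} p (y w : R) :
  `|cos (y + w) - cos_taylor p y w| <= `|w| ^+ p.
Proof.
elim: p y w => [|p IH] y w.
  by rewrite /cos_taylor big_ord0 subr0 expr0 normr_cos_le1.
pose f x := cos (y + x) - cos_taylor p.+1 y x.
pose df x := cos (y + pi / 2 + x) - cos_taylor p (y + pi / 2) x.
have fd (x : R) : is_derive x 1 f (df x).
  have d1 : is_derive x 1 (cos \o (+%R y)) (cos (y + pi / 2 + x)).
    have dy : is_derive x 1 (+%R y) 1.
      have -> : +%R y = cst y + id by [].
      by apply: is_derive_eq; rewrite add0r.
    apply: is_derive_eq.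
    by rewrite addrAC cosDpihalf /GRing.scale/= mulr1.
  exact: is_deriveB d1 (is_derive_cos_taylor _ _ _).
have cf : continuous f := is_derive_continuous fd.
have f0 : f 0 = 0.
  rewrite /f /cos_taylor big_ord_recl/= expr0 mul0r !addr0 fact0 divr1 mul1r.
  by rewrite big1 ?addr0 ?subrr// => i _; rewrite expr0n/= !mul0r.
have key c : `|c| <= `|w| -> `|df c * w| <= `|w| ^+ p.+1.
  move=> cw; rewrite normrM exprSr ler_wpM2r//.
  by apply: le_trans (IH _ _) _; rewrite lerXn2r ?nnegrE.
rewrite -/(f w); have [w0|w0] := leP 0 w.
  have [c] := MVT_segment w0 (fun x _ => fd x) (continuous_subspaceT cf).
  rewrite in_itv/= f0 !subr0 => /andP[c0 cw] ->; apply: key.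
  by rewrite !ger0_norm.
have [c] := MVT_segment (ltW w0) (fun x _ => fd x) (continuous_subspaceT cf).
rewrite in_itv/= f0 !sub0r => /andP[c0 cw] /eqP.
rewrite mulrN eqr_opp => /eqP ->; apply: key.
by rewrite !ler0_norm ?lerN2// ltW.
Qed.

(** * A harmonic against powers of a cosine sum *)

Definition cos_sum {R : realType} (m : nat -> nat) (b : nat -> R) (i k : nat)
  (x : R) : R := \sum_(i <= l < k) b l * harm (m l) x.

Lemma continuous_cos_sum {R : realType} m (b : nat -> R) i k :
  continuous (cos_sum m b i k).
Proof.
apply: continuous_sumr => l x.
by apply: cvgM; [exact: cvg_cst|exact: continuous_harm].
Qed.

Lemma continuous_expr {R : realType} (f : R -> R) j :
  continuous f -> continuous (fun x => f x ^+ j).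
Proof.
move=> cf; elim: j => [|j IH].
  by under eq_fun do rewrite expr0; move=> x; exact: cvg_cst.
by under eq_fun do rewrite exprS; move=> x; apply: cvgM; [exact: cf|exact: IH].
Qed.

Lemma normr_cos_sum_le {R : realType} m (b : nat -> R) i k x :
  `|cos_sum m b i k x| <= \sum_(i <= l < k) `|b l|.
Proof.
apply: le_trans (ler_norm_sum _ _ _) _; apply: ler_sum => l _.
by rewrite normrM ler_piMr// normr_cos_le1.
Qed.

(** Multiplying [harm M] by one cosine of frequency at most [h] averages two
harmonics of frequency at least [M - h].  So [j] factors of the cosine sum cost
a factor [B ^ j], and the frequency available for the integration by parts
drops to [M - j h]. *)
Lemma mean_harm_cos_sumX_le {R : realType} m (b : nat -> R) i k (h B D : R)
    (g dg : R -> R) :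
  (forall x : R, is_derive x 1 g (dg x)) -> continuous dg ->
  (forall x, `|dg x| <= 2 * pi * D) ->
  0 <= h -> (forall l, (i <= l < k)%N -> (m l)%:R <= h) ->
  \sum_(i <= l < k) `|b l| <= B ->
  forall j M, j%:R * h < M%:R ->
  `|mean (fun x => harm M x * (cos_sum m b i k x ^+ j * g x))|
    <= B ^+ j * (D / (M%:R - j%:R * h)).
Proof.
move=> gd cdg dgD h0 mh bB.
have cg := is_derive_continuous gd.
have D0 : 0 <= D.
  have := le_trans (normr_ge0 _) (dgD 0).
  by rewrite pmulr_rge0// mulr_gt0// pi_gt0.
have B0 : 0 <= B by apply: le_trans bB; apply: sumr_ge0.
set W := cos_sum m b i k.
elim => [|j IH] M jM.
  rewrite expr0 mul1r mul0r subr0.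
  under eq_mean do rewrite expr0 mul1r.
  apply: (mean_harmM_le _ _ g dg) => //.
  by move: jM; rewrite mul0r ltr0n.
pose F M x := harm M x * (W x ^+ j * g x).
have cF N : continuous (F N).
  move=> x; apply: cvgM; first exact: continuous_harm.
  by apply: cvgM; [exact/continuous_expr/continuous_cos_sum|exact: cg].
have jhS : j.+1%:R * h = j%:R * h + h by rewrite -natr1 mulrDl mul1r.
have jh0 : 0 <= j%:R * h by rewrite mulr_ge0.
have mM l : (i <= l < k)%N -> (m l <= M)%N.
  move=> /mh lh; rewrite -(ler_nat R); apply: le_trans lh _.
  by apply: le_trans (ltW jM); rewrite jhS lerDr.
have -> : mean (fun x => harm M x * (W x ^+ j.+1 * g x)) =
    \sum_(i <= l < k) (b l / 2) * (mean (F (M + m l)%N) + mean (F (M - m l)%N)).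
  transitivity (mean (fun x => \sum_(i <= l < k)
      (b l / 2) * (F (M + m l)%N x + F (M - m l)%N x))).
    apply: eq_mean => x; rewrite exprSr -!mulrA mulrCA mulr_suml.
    rewrite mulr_sumr mulr_sumr; apply: eq_big_nat => l /mM lM.
    rewrite /F -mulrDl; have := harmM M (m l) x lM.
    move=> H; rewrite -[_ / 2 * _]mulrA [2^-1 * _]mulrA -H; ring.
  rewrite mean_sum; last first.
    move=> l x; apply: cvgM; first exact: cvg_cst.
    by apply: cvgD; exact: cF.
  apply: eq_bigr => l _; rewrite meanZ ?meanD//.
  by move=> x; apply: cvgD; exact: cF.
have d0 : 0 < M%:R - j.+1%:R * h by rewrite subr_gt0.
set X := D / (M%:R - j.+1%:R * h).
have X0 : 0 <= X by rewrite divr_ge0// ltW.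
apply: le_trans (ler_norm_sum _ _ _) _.
apply: (@le_trans _ _ (\sum_(i <= l < k) `|b l| * (B ^+ j * X))); last first.
  by rewrite -mulr_suml exprS -mulrA ler_wpM2r// mulr_ge0// exprn_ge0.
apply: ler_sum_nat => l lik; have lM := mM _ lik; have lh := mh _ lik.
have ml0 : 0 <= (m l)%:R :> R by [].
have bound N : M%:R - (m l)%:R <= N%:R :> R -> `|mean (F N)| <= B ^+ j * X.
  move=> MN.
  have NX : M%:R - j.+1%:R * h <= N%:R - j%:R * h by rewrite jhS; lra.
  apply: le_trans (IH N _) _; first by rewrite -subr_gt0; apply: lt_le_trans NX.
  rewrite ler_wpM2l ?exprn_ge0// ler_wpM2l// lef_pV2// posrE//.
  exact: lt_le_trans NX.
rewrite -[_ / 2 * _]mulrA normrM ler_wpM2l// normrM ger0_norm//.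
rewrite ler_pdivrMl//.
apply: le_trans (ler_normD _ _) _.
have := bound (M + m l)%N; have := bound (M - m l)%N.
rewrite natrB// natrD => /(_ (lexx _)) H1 /(_ _) H2.
have {}H2 := H2 ltac:(lra); lra.
Qed.

Lemma continuous_cosD {R : realType} (t c : R) (f : R -> R) :
  continuous f -> continuous (fun x => cos (t * f x + c)).
Proof.
move=> cf x; apply: continuous_comp; last exact: continuous_cos.
by apply: cvgD; [apply: cvgM; [exact: cvg_cst|exact: cf]|exact: cvg_cst].
Qed.

Lemma is_derive_cosD {R : realType} (t c : R) {f df : R -> R} :
  (forall x : R, is_derive x 1 f (df x)) ->
  forall x : R, is_derive x 1 (fun x => cos (t * f x + c))
                  (- (t * df x * sin (t * f x + c))).
Proof.
move=> fd x.
have dl : is_derive x 1 (fun x => t * f x + c) (t * df x).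
  have -> : (fun x => t * f x + c) = t \*: f + cst c by [].
  by apply: is_derive_eq; rewrite addr0.
have -> : (fun x => cos (t * f x + c)) = cos \o (fun x => t * f x + c) by [].
by apply: is_derive_eq; rewrite /GRing.scale/=; ring.
Qed.

(** The slow part [V] and the window [cos_sum m b i k] are treated differently:
the exponential of the window is expanded up to order [p], which leaves trigonometric
polynomials of degree less than [p] in the window multiplied by a slow function. *)
Lemma mean_harm_cos_le {R : realType} m (b : nat -> R) i k (h B D t c : R)
    (p N : nat) (V dV : R -> R) :
  (forall x : R, is_derive x 1 V (dV x)) -> continuous dV ->
  (forall x, `|dV x| <= 2 * pi * D) ->
  0 <= h -> (forall l, (i <= l < k)%N -> (m l)%:R <= h) ->
  \sum_(i <= l < k) `|b l| <= B -> `|t| * B <= 1 ->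
  p.-1%:R * h < N%:R ->
  `|mean (fun x => harm N x * cos (t * (V x + cos_sum m b i k x) + c))|
    <= p%:R * (`|t| * D / (N%:R - p.-1%:R * h)) + (`|t| * B) ^+ p.
Proof.
move=> Vd cdV dVD h0 mh bB tB pN.
have cV := is_derive_continuous Vd.
have D0 : 0 <= D.
  have := le_trans (normr_ge0 _) (dVD 0).
  by rewrite pmulr_rge0// mulr_gt0// pi_gt0.
have B0 : 0 <= B by apply: le_trans bB; apply: sumr_ge0.
set W := cos_sum m b i k.
have cW : continuous W := continuous_cos_sum m b i k.
have WB x : `|W x| <= B by apply: le_trans bB; exact: normr_cos_sum_le.
pose g (j : nat) x := cos (t * V x + (c + j%:R * (pi / 2))).
have cg j : continuous (g j) by exact: continuous_cosD.
pose F j x := harm N x * (W x ^+ j * g j x).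
have ch := @continuous_harm R N.
have cF j : continuous (F j).
  move=> x; apply: cvgM; first exact: ch.
  by apply: cvgM; [exact: continuous_expr|exact: cg].
pose T x := \sum_(j < p) t ^+ j / j`!%:R * F j x.
have cFt (j : 'I_p) : continuous (fun x => t ^+ j / j`!%:R * F j x).
  by move=> x; apply: cvgM; [exact: cvg_cst|exact: cF].
have cT : continuous T by exact: continuous_sumr.
pose G x := harm N x * cos (t * (V x + W x) + c).
have cG : continuous G.
  have cVW : continuous (fun x => V x + W x).
    by move=> x; apply: cvgD; [exact: cV|exact: cW].
  by move=> x; apply: cvgM; [exact: ch|exact: (continuous_cosD t c _ cVW)].
have -> : mean G = mean T + mean (fun x => G x - T x).
  rewrite -meanD//; last by move=> x; apply: cvgB; [exact: cG|exact: cT].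
  by apply: eq_mean => x; rewrite addrC subrK.
apply: le_trans (ler_normD _ _) _; apply: lerD; last first.
  apply: normr_mean_le.
    by move=> x; apply: cvgB; [exact: cG|exact: cT].
  move=> x.
  have -> : G x - T x =
      harm N x * (cos (t * V x + c + t * W x)
                  - cos_taylor p (t * V x + c) (t * W x)).
    rewrite mulrBr; congr (_ - _).
      by rewrite /G; congr (_ * cos _); ring.
    rewrite /T /cos_taylor mulr_sumr; apply: eq_bigr => j _.
    by rewrite /F /g exprMn -[t * V x + c + _]addrA; ring.
  rewrite normrM -[leRHS]mul1r; apply: ler_pM => //; first exact: normr_cos_le1.
  apply: le_trans (cos_taylor_le _ _ _) _.
  rewrite lerXn2r ?nnegrE ?mulr_ge0// normrM.
  by rewrite ler_wpM2l.
rewrite /T mean_sum//.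
set X := `|t| * D / (N%:R - p.-1%:R * h).
have d0 : 0 < N%:R - p.-1%:R * h by rewrite subr_gt0.
have X0 : 0 <= X by rewrite divr_ge0 ?mulr_ge0// ltW.
apply: le_trans (ler_norm_sum _ _ _) _.
apply: (@le_trans _ _ (\sum_(j < p) X)); last first.
  by rewrite sumr_const card_ord mulr_natl.
apply: ler_sum => j _; rewrite meanZ//.
have jp : j%:R * h <= p.-1%:R * h.
  by rewrite ler_wpM2r// ler_nat; case: (p) j => [[]//|p' j]; rewrite -ltnS.
have dg := is_derive_cosD t (c + j%:R * (pi / 2)) Vd.
have cdg : continuous (fun x =>
    - (t * dV x * sin (t * V x + (c + j%:R * (pi / 2))))).
  move=> x; apply: cvgN; apply: cvgM.
    by apply: cvgM; [exact: cvg_cst|exact: cdV].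
  apply: continuous_comp; last exact: continuous_sin.
  by apply: cvgD; [apply: cvgM; [exact: cvg_cst|exact: cV]|exact: cvg_cst].
have dgD x : `|- (t * dV x * sin (t * V x + (c + j%:R * (pi / 2))))|
    <= 2 * pi * (`|t| * D).
  rewrite normrN normrM [leRHS](_ : _ = `|t| * (2 * pi * D) * 1); last by ring.
  apply: ler_pM => //; last exact: normr_sin_le1.
  by rewrite normrM ler_wpM2l.
have jN : j%:R * h < N%:R by apply: le_lt_trans jp pN.
have H := mean_harm_cos_sumX_le m b i k h B (`|t| * D) _ _ dg cdg dgD h0 mh bB
  j N jN.
rewrite normrM normrM normfV [`|j`!%:R|]ger0_norm// normrX.
apply: (@le_trans _ _ (`|t| ^+ j / j`!%:R * (B ^+ j * X))).
  rewrite ler_wpM2l ?divr_ge0 ?exprn_ge0//.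
  apply: le_trans H _; rewrite ler_wpM2l ?exprn_ge0// ler_wpM2l ?mulr_ge0//.
  by rewrite lef_pV2 ?posrE ?subr_gt0// lerB.
have -> : `|t| ^+ j / j`!%:R * (B ^+ j * X)
    = (`|t| * B) ^+ j * j`!%:R^-1 * X by rewrite exprMn; ring.
rewrite -[leRHS]mul1r ler_wpM2r//; apply: mulr_ile1 => //.
- by rewrite exprn_ge0// mulr_ge0.
- by rewrite exprn_ile1// mulr_ge0.
- by rewrite invf_le1 ?ltr0n ?fact_gt0// ler1n fact_gt0.
Qed.

(** * Lacunary frequencies *)

Definition lacunary {R : realType} (q : R) (m : nat -> nat) : Prop :=
  forall k, (1 <= k)%N -> q * (m k)%:R <= (m k.+1)%:R.

Lemma lacunary_pow {R : realType} {q : R} {m : nat -> nat} i j :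
  1 < q -> lacunary q m -> (1 <= i)%N -> q ^+ j * (m i)%:R <= (m (i + j)%N)%:R.
Proof.
move=> q1 mgap i1; elim: j => [|j IH]; first by rewrite expr0 mul1r addn0.
rewrite addnS exprS -mulrA; apply: le_trans (mgap _ _); last first.
  by rewrite (leq_trans i1)// leq_addr.
by rewrite ler_wpM2l// ltW// (lt_trans _ q1).
Qed.

Lemma lacunary_lt {R : realType} {q : R} {m : nat -> nat} l k :
  1 < q -> lacunary q m -> (1 <= l < k)%N -> (m l)%:R <= (m k)%:R / q.
Proof.
move=> q1 mgap /andP[l1 lk]; rewrite ler_pdivlMr ?(lt_trans _ q1)// mulrC.
have := lacunary_pow l (k - l) q1 mgap l1; rewrite subnKC 1?ltnW//; apply: le_trans.
rewrite ler_wpM2r// -[leLHS]expr1 ler_weXn2l 1?ltW//.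
by rewrite subn_gt0.
Qed.

(** The frequencies grow at least geometrically, so that their sum is
comparable with the next one. *)
Lemma lacunary_sum {R : realType} {q : R} {m : nat -> nat} i :
  1 < q -> lacunary q m -> (1 <= i)%N ->
  \sum_(1 <= l < i) (m l)%:R <= (m i)%:R / (q - 1).
Proof.
move=> q1 mgap; have q10 : 0 < q - 1 by rewrite subr_gt0.
case: i => // i _; elim: i => [|i IH].
  by rewrite big_geq// divr_ge0// ltW.
rewrite big_nat_recr//=; apply: (@le_trans _ _ (q * (m i.+1)%:R / (q - 1))).
  apply: le_trans (lerD IH (lexx _)) _.
  rewrite -[X in _ + X](mulfK (lt0r_neq0 q10)) -mulrDl.
  rewrite ler_wpM2r ?invr_ge0 ?(ltW q10)//.
  by rewrite mulrBr mulr1 addrC subrK mulrC.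
by rewrite ler_wpM2r ?invr_ge0 ?(ltW q10)// mgap.
Qed.

(** The first summand bounds the means in which the frequencies below the window
of length [L] are slow; the second is the Taylor remainder of the window. *)
Definition osc_bound {R : realType} (q : R) (p L : nat) (d t : R) : R :=
  p%:R * (`|t| * d / q ^+ L * (q / ((q - 1) * (q - p.-1%:R))))
  + (`|t| * (L%:R * d)) ^+ p.

Lemma osc_bound_ge0 {R : realType} (q : R) (p L : nat) (d t : R) :
  1 < q -> p.-1%:R < q -> 0 <= d -> 0 <= osc_bound q p L d t.
Proof.
move=> q1 pq d0; have q0 : 0 <= q by rewrite ltW// (lt_trans _ q1).
rewrite addr_ge0// ?exprn_ge0 ?mulr_ge0//.
- by rewrite invr_ge0 exprn_ge0.
- by rewrite invr_ge0 mulr_ge0// subr_ge0 ltW.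
Qed.

Lemma is_derive_cos_sum {R : realType} m (b : nat -> R) i k (x : R) :
  is_derive x 1 (cos_sum m b i k)
    (\sum_(i <= l < k) b l * - (2 * pi * (m l)%:R * sin (2 * pi * (m l)%:R * x))).
Proof.
elim: k => [|k IH].
  have -> : cos_sum m b i 0 = cst 0.
    by apply/funext => y; rewrite /cos_sum big_geq.
  by rewrite big_geq//; exact: is_derive_cst.
have [ik|ki] := leqP i k; last first.
  have -> : cos_sum m b i k.+1 = cst 0.
    by apply/funext => y; rewrite /cos_sum big_geq.
  by rewrite big_geq//; exact: is_derive_cst.
have -> : cos_sum m b i k.+1 = cos_sum m b i k + b k \*: harm (m k).
  by apply/funext => y; rewrite /cos_sum big_nat_recr.
rewrite big_nat_recr//=.
have H := is_derive_harm (m k) x.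
exact: is_deriveD.
Qed.

(** Frequencies below the window are smaller than [m k] by a factor [q ^ L], even
after summation, and a product of [p.-1] frequencies below [m k] lowers [N] by at
most [p.-1 * m k / q]. *)
Lemma mean_harm_lacunary_le {R : realType} (q : R) m (b : nat -> R)
    (p k N L : nat) (d t c : R) :
  1 < q -> lacunary q m -> p.-1%:R < q ->
  (1 <= k)%N -> (0 < m k)%N -> (m k <= N)%N ->
  0 <= d -> (forall l, (1 <= l < k)%N -> `|b l| <= d) ->
  `|t| * (L%:R * d) <= 1 ->
  `|mean (fun x => harm N x * cos (t * cos_sum m b 1 k x + c))|
    <= osc_bound q p L d t.
Proof.
move=> q1 mq pq k1 mk0 mkN d0 bd tLd.
have q0 : 0 < q by rewrite (lt_trans _ q1).
have q10 : 0 < q - 1 by rewrite subr_gt0.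
have qp0 : 0 < q - p.-1%:R by rewrite subr_gt0.
have mk0R : 0 < (m k)%:R :> R by rewrite ltr0n.
(* The window is [i <= l < k]; it is cut at [1], the first frequency. *)
pose i := maxn 1 (k - L).
have i1 : (1 <= i)%N by rewrite leq_maxl.
have ik : (i <= k)%N by rewrite geq_max k1 leq_subr.
pose V := cos_sum m b 1 i.
pose dV x := \sum_(1 <= l < i)
  b l * - (2 * pi * (m l)%:R * sin (2 * pi * (m l)%:R * x)).
pose D := d * ((m k)%:R / q ^+ L / (q - 1)).
have Vd (x : R) : is_derive x 1 V (dV x) by exact: is_derive_cos_sum.
have cdV : continuous dV.
  apply: continuous_sumr => l x; apply: cvgM; first exact: cvg_cst.
  apply: cvgN; apply: cvgM; first exact: cvg_cst.
  apply: continuous_comp; last exact: continuous_sin.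
  by apply: cvgM; [exact: cvg_cst|exact: cvg_id].
have msum : \sum_(1 <= l < i) (m l)%:R <= (m k)%:R / q ^+ L / (q - 1).
  have [kL|Lk] := leqP k L.
    have -> : i = 1%N by rewrite /i (eqP kL).
    by rewrite big_geq// !divr_ge0// ?exprn_ge0 ?(ltW q0) ?(ltW q10).
  have iE : i = (k - L)%N by rewrite /i; apply/maxn_idPr; rewrite subn_gt0.
  apply: le_trans (lacunary_sum i q1 mq i1) _.
  rewrite ler_wpM2r ?invr_ge0 ?(ltW q10)// ler_pdivlMr ?exprn_gt0// mulrC.
  by have := lacunary_pow i L q1 mq i1; rewrite {2}iE subnK// ltnW.
have dVD x : `|dV x| <= 2 * pi * D.
  rewrite /dV; apply: le_trans (ler_norm_sum _ _ _) _.
  apply: (@le_trans _ _ (\sum_(1 <= l < i) 2 * pi * d * (m l)%:R)).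
    apply: ler_sum_nat => l /andP[l1 li].
    rewrite normrM normrN normrM [leRHS](_ : _ = d * (2 * pi * (m l)%:R)).
      apply: ler_pM => //; first by rewrite bd// l1 (leq_trans li).
      rewrite ger0_norm ?mulr_ge0 ?pi_ge0//.
      by rewrite ler_piMr ?mulr_ge0 ?pi_ge0// normr_sin_le1.
    by ring.
  rewrite -mulr_sumr /D [leRHS]mulrA ler_wpM2l// ?mulr_ge0 ?pi_ge0//.
have SB : \sum_(i <= l < k) `|b l| <= L%:R * d.
  apply: (@le_trans _ _ (\sum_(i <= l < k) d)).
    apply: ler_sum_nat => l /andP[il lk].
    by rewrite bd// lk (leq_trans i1 il).
  rewrite sumr_const_nat -[leLHS]mulr_natl ler_wpM2r// ler_nat.
  by rewrite leq_subLR addnC -leq_subLR leq_maxr.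
pose h : R := (m k)%:R / q.
have h0 : 0 <= h by rewrite divr_ge0// ltW.
have mh l : (i <= l < k)%N -> (m l)%:R <= h.
  move=> /andP[il lk]; apply: lacunary_lt => //.
  by rewrite lk (leq_trans i1 il).
have dN : (m k)%:R * ((q - p.-1%:R) / q) <= N%:R - p.-1%:R * h.
  have -> : (m k)%:R * ((q - p.-1%:R) / q) = (m k)%:R - p.-1%:R * h.
    by rewrite /h; field; rewrite gt_eqF.
  by rewrite lerB// ler_nat.
have d0' : 0 < (m k)%:R * ((q - p.-1%:R) / q) by rewrite mulr_gt0// divr_gt0.
have pN : p.-1%:R * h < N%:R by rewrite -subr_gt0; apply: lt_le_trans dN.
have := mean_harm_cos_le m b i k h (L%:R * d) D t c p N V dV Vd cdV dVD h0 mh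
  SB tLd pN.
have -> : (fun x => harm N x * cos (t * (V x + cos_sum m b i k x) + c)) =
          (fun x => harm N x * cos (t * cos_sum m b 1 k x + c)).
  apply/funext => x; rewrite /V /cos_sum.
  by rewrite [in RHS](big_cat_nat i1 ik).
move=> /le_trans; apply; rewrite /osc_bound lerD2r ler_wpM2l//.
have -> : `|t| * d / q ^+ L * (q / ((q - 1) * (q - p.-1%:R))) =
    `|t| * D / ((m k)%:R * ((q - p.-1%:R) / q)).
  rewrite /D; field.
  by rewrite !gt_eqF// exprn_gt0.
have D0 : 0 <= D.
  by rewrite mulr_ge0// !divr_ge0// ?exprn_ge0 ?(ltW q0) ?(ltW q10).
rewrite ler_wpM2l ?(mulr_ge0 (normr_ge0 t) D0)//.
by rewrite lef_pV2// posrE (lt_le_trans d0').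
Qed.

(** * Removing the highest frequency *)

(** In the Taylor expansion of order 4, the powers of [harm M] are linear
combinations of [1], [harm M], [harm (2 M)] and [harm (3 M)].  Among the positive
powers only the square has a constant part, [1 / 2]; with [u ^ 2 / 2] in front,
it gives [u ^ 2 / 4]. *)
Lemma mean_cos_step {R : realType} (M : nat) (Y : R -> R) (u c eta : R) :
  continuous Y -> `|u| <= 1 ->
  (forall N c', (M <= N)%N -> `|mean (fun x => harm N x * cos (Y x + c'))| <= eta) ->
  `|mean (fun x => cos (Y x + u * harm M x + c))
     - (1 - u ^+ 2 / 4) * mean (fun x => cos (Y x + c))|
   <= 2 * `|u| * eta + `|u| ^+ 4.
Proof.
move=> cY u1 He.
have eta0 : 0 <= eta := le_trans (normr_ge0 _) (He M 0 (leqnn _)).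
have cC c' : continuous (fun x => cos (Y x + c')).
  move=> x; apply: continuous_comp; last exact: continuous_cos.
  by apply: cvgD; [exact: cY|exact: cvg_cst].
have ch := @continuous_harm R.
pose F N c' x := harm N x * cos (Y x + c').
have cF N c' : continuous (F N c').
  by move=> x; apply: cvgM; [exact: ch|exact: cC].
pose G x := cos (Y x + u * harm M x + c).
have cG : continuous G.
  move=> x; apply: continuous_comp; last exact: continuous_cos.
  apply: cvgD; last exact: cvg_cst.
  by apply: cvgD; [exact: cY|apply: cvgM; [exact: cvg_cst|exact: ch]].
pose T x := cos_taylor 4 (Y x + c) (u * harm M x).
pose c1 := c + pi / 2; pose c2 := c + pi; pose c3 := c + 3 * (pi / 2).
have cosM2 x : harm M x ^+ 2 = 2^-1 + 2^-1 * harm (M + M) x :> R.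
  have := harmM M M x (leqnn _); rewrite subnn {4}/harm mulr0 mul0r cos0 -expr2.
  by move=> ->; rewrite mulrDr mulr1 addrC.
have cosM3 x : harm M x ^+ 3 =
    3 / 4 * harm M x + 4^-1 * harm (M + M + M) x :> R.
  rewrite exprSr cosM2 mulrDl -[2^-1 * _ * _]mulrA (harmM (M + M) M) ?leq_addr//.
  by rewrite addnK; field.
have TE x : T x = cos (Y x + c) - u ^+ 2 / 4 * cos (Y x + c)
    + (u * F M c1 x - u ^+ 2 / 4 * F (M + M)%N c x
       + u ^+ 3 / 6 * (3 / 4 * F M c3 x + 4^-1 * F (M + M + M)%N c3 x)).
  rewrite /T /cos_taylor !big_ord_recr big_ord0/= expr0 expr1 mul0r !addr0 add0r.
  rewrite mul1r !exprMn cosM2 cosM3 /F.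
  have -> : Y x + c + 2 * (pi / 2) = Y x + c + pi by field.
  rewrite cosDpi /c1 /c3 !addrA mul1r.
  rewrite (_ : 0`! = 1%N)// (_ : 1`! = 1%N)// (_ : 2`! = 2%N)// (_ : 3`! = 6%N)//.
  by field.
have cZ (f : R -> R) r : continuous f -> continuous (fun x => r * f x).
  by move=> cf x; apply: cvgM; [exact: cvg_cst|exact: cf].
have cD (f g : R -> R) : continuous f -> continuous g ->
    continuous (fun x => f x + g x).
  by move=> cf cg x; apply: cvgD; [exact: cf|exact: cg].
pose r := - (u ^+ 2 / 4).
pose f1 x := cos (Y x + c) + r * cos (Y x + c).
pose f2 x := u * F M c1 x + r * F (M + M)%N c x.
pose f3 x := u ^+ 3 / 8 * F M c3 x + u ^+ 3 / 24 * F (M + M + M)%N c3 x.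
have cf1 : continuous f1 by apply: cD; [exact: cC|apply: cZ; exact: cC].
have cf2 : continuous f2 by apply: cD; apply: cZ; exact: cF.
have cf3 : continuous f3 by apply: cD; apply: cZ; exact: cF.
have TF : T = (fun x => f1 x + (f2 x + f3 x)).
  by apply/funext => x; rewrite TE /f1 /f2 /f3 /r; field.
have cT : continuous T by rewrite TF; exact: (cD f1 _ cf1 (cD f2 f3 cf2 cf3)).
have cGT : continuous (fun x => G x - T x).
  by move=> x; apply: cvgB; [exact: cG|exact: cT].
have -> : mean G = mean T + mean (fun x => G x - T x).
  by rewrite -meanD//; apply: eq_mean => x; rewrite addrC subrK.
have -> : mean T = mean f1 + (mean f2 + mean f3).
  by rewrite TF (meanD f1 _ cf1 (cD f2 f3 cf2 cf3)) (meanD f2 f3).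
have -> : mean f1 = (1 - u ^+ 2 / 4) * mean (fun x => cos (Y x + c)).
  by rewrite /f1 meanD ?meanZ//; [rewrite /r; ring|exact/cZ/cC].
have -> : mean f2 = u * mean (F M c1) + r * mean (F (M + M)%N c).
  by rewrite /f2 meanD ?meanZ//; apply: cZ.
have -> : mean f3 = u ^+ 3 / 8 * mean (F M c3)
                    + u ^+ 3 / 24 * mean (F (M + M + M)%N c3).
  by rewrite /f3 meanD ?meanZ//; apply: cZ.
have H1 := He M c1 (leqnn _).
have H2 := He (M + M)%N c (leq_addr _ _).
have H3 := He M c3 (leqnn _).
have H4 := He (M + M + M)%N c3 (leq_trans (leq_addr _ _) (leq_addr _ _)).
have H5 : `|mean (fun x => G x - T x)| <= `|u| ^+ 4.
  apply: normr_mean_le => // x.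
  have -> : G x - T x = cos (Y x + c + u * harm M x)
      - cos_taylor 4 (Y x + c) (u * harm M x).
    by rewrite /G addrAC.
  apply: le_trans (cos_taylor_le _ _ _) _.
  by rewrite lerXn2r ?nnegrE// normrM ler_piMr// normr_cos_le1.
have u2 : `|u| ^+ 2 <= `|u|.
  by rewrite expr2 ler_piMr.
have u3 : `|u| ^+ 3 <= `|u|.
  by rewrite exprS ler_piMr// exprn_ile1.
set C := (1 - u ^+ 2 / 4) * _.
rewrite [X in `|X| <= _](_ : _ = u * mean (F M c1) + r * mean (F (M + M)%N c)
   + u ^+ 3 / 8 * mean (F M c3) + u ^+ 3 / 24 * mean (F (M + M + M)%N c3)
   + mean (fun x => G x - T x)); last by ring.
apply: le_trans (ler_normD _ _) _; apply: lerD => //.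
apply: (@le_trans _ _ (`|u| * eta + `|u| / 4 * eta + `|u| / 8 * eta
   + `|u| / 24 * eta)); last first.
  have : 0 <= `|u| * eta by rewrite mulr_ge0.
  lra.
apply: le_trans (ler_normD _ _) _; apply: lerD.
  apply: le_trans (ler_normD _ _) _; apply: lerD.
    apply: le_trans (ler_normD _ _) _; apply: lerD.
      by rewrite normrM ler_wpM2l.
    rewrite normrM; apply: ler_pM => //.
    by rewrite /r normrN normrM normrX normfV [`|4|]ger0_norm// ler_wpM2r.
  rewrite normrM; apply: ler_pM => //.
  by rewrite normrM normrX normfV [`|8|]ger0_norm// ler_wpM2r.
rewrite normrM; apply: ler_pM => //.
by rewrite normrM normrX normfV [`|24|]ger0_norm// ler_wpM2r.
Qed.

(** With [x = 2 sqrt k], the maximum of [(1 - u^2 / 4) x + u] over [u] is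
[x + 1 / x], attained at [u = 2 / x], and [(x + 1 / x)^2 <= x^2 + 4] for
[1 <= k]. *)
Lemma contraction_sqrt_le {R : realType} (k : nat) (u : R) : 0 <= u <= 1 ->
  (1 - u ^+ 2 / 4) * (2 * Num.sqrt k%:R) + u <= 2 * Num.sqrt k.+1%:R.
Proof.
move=> /andP[u0 u1]; case: k => [|k].
  by rewrite sqrtr0 !mulr0 add0r sqrtr1; lra.
set s := Num.sqrt k.+1%:R; set s' := Num.sqrt k.+2%:R.
have s0 : 0 < s by rewrite sqrtr_gt0 ltr0n.
have s2 : s ^+ 2 = k.+1%:R by rewrite sqr_sqrtr// ler0n.
have s'2 : s' ^+ 2 = s ^+ 2 + 1 by rewrite s2 sqr_sqrtr ?ler0n// natr1.
have s1 : 1 <= s ^+ 2 by rewrite s2 ler1n.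
apply: (@le_trans _ _ (2 * s + (2 * s)^-1)).
  rewrite -subr_ge0.
  have -> : 2 * s + (2 * s)^-1 - ((1 - u ^+ 2 / 4) * (2 * s) + u)
    = (u * s - 1) ^+ 2 / (2 * s) by field; rewrite gt_eqF.
  by rewrite divr_ge0 ?sqr_ge0// mulr_ge0// ltW.
rewrite -ler_sqr ?nnegrE ?addr_ge0 ?invr_ge0 ?mulr_ge0 ?sqrtr_ge0 ?(ltW s0)//.
have -> : (2 * s + (2 * s)^-1) ^+ 2 = 4 * s ^+ 2 + 2 + (4 * s ^+ 2)^-1.
  by field; rewrite gt_eqF.
rewrite exprMn s'2.
have : (4 * s ^+ 2)^-1 <= 1 by rewrite invf_le1; lra.
lra.
Qed.

(** Induction on the number of terms: the error after [k] terms is at most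
[2 sqrt k * eta], by [mean_cos_step] and [contraction_sqrt_le]. *)
Lemma mean_cos_lacunary_le {R : realType} (q : R) m (b : nat -> R)
    (p n L : nat) (d t c : R) :
  1 < q -> lacunary q m -> p.-1%:R < q -> (forall k, (1 <= k)%N -> (0 < m k)%N) ->
  0 <= d -> (forall l, (1 <= l <= n)%N -> `|b l| <= d) ->
  (0 < L)%N -> `|t| * (L%:R * d) <= 1 ->
  `|mean (fun x => cos (t * cos_sum m b 1 n.+1 x + c))
     - cos c * \prod_(1 <= l < n.+1) (1 - (t * b l) ^+ 2 / 4)|
    <= 2 * Num.sqrt n%:R * (2 * osc_bound q p L d t + (`|t| * d) ^+ 3).
Proof.
move=> q1 mq pq m0 d0 bd L0 tLd.
set eta0 := osc_bound q p L d t; set eta := 2 * eta0 + _.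
have eta00 : 0 <= eta0 by exact: osc_bound_ge0.
have eta_ge0 : 0 <= eta.
  by rewrite addr_ge0 ?mulr_ge0 ?exprn_ge0 ?mulr_ge0.
have td : `|t| * d <= 1.
  apply: le_trans tLd; rewrite ler_wpM2l//.
  by rewrite -[leLHS]mul1r ler_wpM2r// ler1n.
have : (n <= n)%N by [].
elim: {-2}n => [|k IH] kn.
  rewrite sqrtr0 mulr0 mul0r big_geq// mulr1.
  rewrite (_ : mean _ = cos c) ?subrr ?normr0//.
  rewrite -[RHS]mean_cst; apply: eq_mean => x.
  by rewrite /cos_sum big_geq// mulr0 add0r.
have {}IH := IH (ltnW kn).
pose u := t * b k.+1.
have utd : `|u| <= `|t| * d by rewrite normrM ler_wpM2l// bd.
have u1 : `|u| <= 1 by exact: le_trans td.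
pose Y x := t * cos_sum m b 1 k.+1 x.
have cY : continuous Y.
  by move=> x; apply: cvgM; [exact: cvg_cst|exact: continuous_cos_sum].
have He N c' : (m k.+1 <= N)%N ->
    `|mean (fun x => harm N x * cos (Y x + c'))| <= eta0.
  move=> kN; apply: (@mean_harm_lacunary_le _ _ _ _ _ k.+1) => //.
    exact: m0.
  by move=> l /andP[l1 lk]; rewrite bd// l1 (leq_trans (ltnW lk)).
have := mean_cos_step (m k.+1) Y u c eta0 cY u1 He.
have -> : (fun x => cos (Y x + u * harm (m k.+1) x + c)) =
          (fun x => cos (t * cos_sum m b 1 k.+2 x + c)).
  apply/funext => x; rewrite /Y /u -mulrA -mulrDr; congr (cos (_ * _ + _)).
  by rewrite [RHS]/cos_sum big_nat_recr.
set A := mean _; set B := mean _ => HA.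
rewrite big_nat_recr//= -/u; set P := \prod_(_ <= _ < _) _.
set r := 1 - u ^+ 2 / 4.
have r0 : 0 <= r.
  have : u ^+ 2 <= 1 by rewrite -(real_normK (num_real u)) exprn_ile1.
  by rewrite /r; lra.
have -> : A - cos c * (P * r) = (A - r * B) + r * (B - cos c * P) by ring.
apply: le_trans (ler_normD _ _) _.
rewrite normrM (ger0_norm r0).
apply: (@le_trans _ _ (`|u| * eta + r * (2 * Num.sqrt k%:R * eta))).
  apply: lerD; last by rewrite ler_wpM2l.
  apply: le_trans HA _; rewrite /eta [leRHS]mulrDr exprS.
  have -> : 2 * `|u| * eta0 = `|u| * (2 * eta0) by ring.
  by rewrite lerD2l ler_wpM2l// lerXn2r ?nnegrE// mulr_ge0.
have -> : `|u| * eta + r * (2 * Num.sqrt k%:R * eta) =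
    ((1 - `|u| ^+ 2 / 4) * (2 * Num.sqrt k%:R) + `|u|) * eta.
  by rewrite real_normK ?num_real// -/r; ring.
by rewrite ler_wpM2r// contraction_sqrt_le// normr_ge0.
Qed.

(** * Products close to an exponential *)

(** The error is controlled term by term through
[1 - x <= exp(- x) <= 1 - x + x ^ 2], all factors being at most [1]. *)
Lemma prod_1B_bounds {R : realType} (I : eqType) (r : seq I) (x : I -> R) :
  {in r, forall i, 0 <= x i <= 1} ->
  0 <= \prod_(i <- r) (1 - x i) <= expR (- \sum_(i <- r) x i) /\
  expR (- \sum_(i <- r) x i) - \prod_(i <- r) (1 - x i)
    <= \sum_(i <- r) x i ^+ 2.
Proof.
elim: r => [|i r IH] x01.
  by rewrite !big_nil oppr0 expR0 ler01 lexx subrr.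
have [/andP[P0 PE] EP] := IH (fun j jr => x01 j (mem_behead (s := i :: r) jr)).
have /andP[xi0 xi1] := x01 i (mem_head _ _).
rewrite !big_cons opprD expRD.
have E1 : expR (- \sum_(j <- r) x j) <= 1.
  rewrite -expR0 ler_expR oppr_le0 big_seq; apply: sumr_ge0 => j jr.
  by have /andP[] := x01 j (mem_behead (s := i :: r) jr).
set P := \prod_(_ <- _) _ in P0 PE EP *.
set E := expR (- \sum_(_ <- _) _) in PE EP E1 *.
set S := \sum_(_ <- _) _ ^+ 2 in EP *.
have E0 : 0 <= E := le_trans P0 PE.
have S0 : 0 <= S by apply: le_trans EP; rewrite subr_ge0.
have e1 : 1 - x i <= expR (- x i) by exact: expR_ge1Dx.
have e2 : expR (- x i) <= 1 - x i + x i ^+ 2.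
  rewrite expRN; apply: (@le_trans _ _ (1 + x i)^-1).
    by rewrite lef_pV2 ?posrE ?expR_gt0 ?expR_ge1Dx//; lra.
  rewrite -[leLHS]mul1r ler_pdivrMr; last lra.
  have -> : (1 - x i + x i ^+ 2) * (1 + x i) = 1 + x i ^+ 3 by ring.
  by rewrite lerDl exprn_ge0.
have y0 : 0 <= 1 - x i by rewrite subr_ge0.
split.
  by rewrite mulr_ge0//= ler_pM.
have -> : expR (- x i) * E - (1 - x i) * P =
  (expR (- x i) - (1 - x i)) * E + (1 - x i) * (E - P) by ring.
apply: lerD.
  apply: (@le_trans _ _ (x i ^+ 2 * 1)); last by rewrite mulr1.
  by apply: ler_pM => //; [rewrite subr_ge0|lra].
by apply: le_trans EP; rewrite ler_piMl ?subr_ge0//; lra.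
Qed.

(** * The window length and the size of the error *)

(** The window is [L n = 1 + floor (ln n / ln q)].  It satisfies
[L n <= C n ^ (eps / p.+1)], so that [L n ^ p.+1] is absorbed by [n ^ eps]. *)
Lemma log_window {R : realType} (q eps : R) (p : nat) (d : nat -> R) :
  1 < q -> 0 < eps -> (forall n, 0 <= d n) ->
  n%:R `^ (1 + eps) * d n ^+ p.+1 @[n --> \oo] --> (0 : R) ->
  exists L : nat -> nat,
    [/\ forall n, (0 < L n)%N,
        forall n, (0 < n)%N -> n%:R <= q ^+ L n
      & n%:R * ((L n)%:R * d n) ^+ p.+1 @[n --> \oo] --> (0 : R)].
Proof.
move=> q1 eps0 d0 dcvg.
have lnq : 0 < ln q by exact: ln_gt0.
have q0 : 0 < q by rewrite (lt_trans _ q1).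
pose L n := (Num.trunc (ln (n%:R : R) / ln q)).+1.
(* [ln n <= n ^ s / s], and the exponent [s] is chosen so that
   [(n ^ s) ^ p.+1 = n ^ eps]. *)
pose s : R := eps / p.+1%:R.
have s0 : 0 < s by rewrite divr_gt0.
pose C := (s * ln q)^-1 + 1.
have C0 : 0 <= C by rewrite addr_ge0// invr_ge0 mulr_ge0// ltW.
exists L; split => // [n n0|].
  have n0R : 0 < n%:R :> R by rewrite ltr0n.
  rewrite -ler_ln ?posrE ?exprn_gt0// lnXn// -[leRHS]mulr_natl.
  by rewrite -ler_pdivrMr// ltW// truncnS_gt.
have LC n : (0 < n)%N -> (L n)%:R <= C * n%:R `^ s.
  move=> n0; have n0R : 0 < n%:R :> R by rewrite ltr0n.
  have ns1 : 1 <= n%:R `^ s.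
    rewrite -[leLHS](powRr0 (n%:R : R)) ler_powR ?ler1n//; exact: ltW.
  have lnn : ln (n%:R : R) <= n%:R `^ s / s.
    rewrite ler_pdivlMr// mulrC -ln_powR.
    by rewrite ltW// ln_sublinear// powR_gt0.
  have ln0 : 0 <= ln (n%:R : R) / ln q by rewrite divr_ge0 ?ln_ge0 ?ler1n// ltW.
  rewrite /L -natr1 /C mulrDl mul1r lerD//.
  have /andP[+ _] := truncn_itv ln0; move=> /le_trans; apply.
  apply: (@le_trans _ _ (n%:R `^ s / s / ln q)).
    by rewrite ler_wpM2r// invr_ge0 ltW.
  have -> : (s * ln q)^-1 * n%:R `^ s = n%:R `^ s / s / ln q.
    by field; rewrite !gt_eqF.
  by [].
apply: (@squeeze_cvgr _ _ _ _ (cst 0)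
    (fun n => C ^+ p.+1 * (n%:R `^ (1 + eps) * d n ^+ p.+1))).
- near=> n.
  have n0 : (0 < n)%N by near: n; exact: nbhs_infty_gt.
  have n0R : 0 < n%:R :> R by rewrite ltr0n.
  apply/andP; split; first by rewrite mulr_ge0// exprn_ge0// mulr_ge0.
  have -> : n%:R `^ (1 + eps) = n%:R * (n%:R `^ s) ^+ p.+1 :> R.
    rewrite powRD; last by rewrite gt_eqF// addr_gt0.
    rewrite powRr1 ?ler0n//; congr (_ * _).
    rewrite -powR_mulrn ?powR_ge0// -powRrM; congr (_ `^ _).
    by rewrite /s divfK// pnatr_eq0.
  rewrite mulrCA -mulrA ler_wpM2l// mulrA -exprMn -exprMn.
  rewrite lerXn2r ?nnegrE ?mulr_ge0 ?powR_ge0//.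
  by rewrite ler_wpM2r// [leRHS]mulrC LC.
- exact: cvg_cst.
- rewrite -[X in _ --> X](mulr0 (C ^+ p.+1)).
  by apply: cvgM; [exact: cvg_cst|exact: dcvg].
Unshelve. all: by end_near. Qed.

Lemma expr_cvg0 {R : realType} (x : nat -> R) p : (forall n, 0 <= x n) ->
  x n ^+ p.+1 @[n --> \oo] --> (0 : R) -> x n @[n --> \oo] --> (0 : R).
Proof.
move=> x0 xp; apply/cvgr0Pnorm_lt => e e0.
have ep : 0 < e ^+ p.+1 by rewrite exprn_gt0.
near=> n; have : `|x n ^+ p.+1| < e ^+ p.+1.
  by near: n; move/cvgr0Pnorm_lt : xp; exact.
by rewrite normrX ltr_pXn2r ?nnegrE// ltW.
Unshelve. all: by end_near.
Qed.

(** [n * d n] times the error of one step.  Every contribution is, up to a constant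
depending on [K], at most [x n] or [n * x n ^ p.+1], where [x n = L n * d n]; the
cubic term needs [p <= 3]. *)
Lemma osc_remainder_cvg {R : realType} (q : R) (p : nat) (d : nat -> R)
    (L : nat -> nat) (K : R) :
  1 < q -> p.-1%:R < q -> (p <= 3)%N -> (forall n, 0 <= d n) -> 0 <= K ->
  (forall n, (0 < L n)%N) -> (forall n, (0 < n)%N -> n%:R <= q ^+ L n) ->
  n%:R * ((L n)%:R * d n) ^+ p.+1 @[n --> \oo] --> (0 : R) ->
  forall e, 0 < e -> \forall n \near \oo, forall t, `|t| <= K ->
    `|t| * ((L n)%:R * d n) <= 1 /\
    n%:R * d n * (2 * osc_bound q p (L n) (d n) t + (`|t| * d n) ^+ 3) <= e.
Proof.
move=> q1 pq p3 d0 K0 L0 Lq dcvg e e0.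
have q0 : 0 < q by rewrite (lt_trans _ q1).
pose x n := (L n)%:R * d n.
have x0 n : 0 <= x n by rewrite mulr_ge0.
have dx n : d n <= x n by rewrite -[leLHS]mul1r ler_wpM2r// ler1n.
have xcvg : x n @[n --> \oo] --> (0 : R).
  apply: (@expr_cvg0 _ _ p) => //.
  apply: (squeeze_cvgr (f := cst 0) _ _ dcvg); last exact: cvg_cst.
  near=> n; rewrite exprn_ge0//= -[leLHS]mul1r ler_wpM2r ?exprn_ge0//.
  by rewrite ler1n; near: n; exact: nbhs_infty_gt.
pose c := q / ((q - 1) * (q - p.-1%:R)).
have c0 : 0 <= c.
  by rewrite divr_ge0 ?mulr_ge0 ?subr_ge0 ?(ltW q0) ?(ltW q1) ?(ltW pq).
pose M1 := 2 * (p%:R * (K * c)); pose M2 := 2 * K ^+ p + K ^+ 3.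
pose w n := M1 * x n + M2 * (n%:R * x n ^+ p.+1).
have wcvg : w n @[n --> \oo] --> (0 : R).
  rewrite -[X in _ --> X](addr0 (0 : R)); apply: cvgD.
    rewrite -[X in _ --> X](mulr0 M1).
    by apply: cvgM; [exact: cvg_cst|exact: xcvg].
  rewrite -[X in _ --> X](mulr0 M2).
  by apply: cvgM; [exact: cvg_cst|exact: dcvg].
have Kxcvg : K * x n @[n --> \oo] --> (0 : R).
  rewrite -[X in _ --> X](mulr0 K).
  by apply: cvgM; [exact: cvg_cst|exact: xcvg].
near=> n => t tK.
have n0 : (0 < n)%N by near: n; exact: nbhs_infty_gt.
have Kx1 : K * x n <= 1.
  by apply/ltW; near: n; exact: (cvgr_lt _ Kxcvg 1 ltr01).
have x1 : x n <= 1.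
  by apply/ltW; near: n; exact: (cvgr_lt _ xcvg 1 ltr01).
have we : w n <= e.
  by apply/ltW; near: n; exact: (cvgr_lt _ wcvg e e0).
split.
  by apply: le_trans Kx1; rewrite -/(x n) ler_wpM2r.
apply: le_trans we; rewrite /osc_bound -/c -/(x n) /w.
have qL0 : 0 < q ^+ L n by rewrite exprn_gt0.
have H1 : n%:R * d n * (p%:R * (`|t| * d n / q ^+ L n * c)) <= p%:R * (K * c) * x n.
  have -> : n%:R * d n * (p%:R * (`|t| * d n / q ^+ L n * c)) =
     (p%:R * (`|t| * c)) * ((n%:R / q ^+ L n) * d n ^+ 2).
    by field; rewrite gt_eqF.
  have nq0 : 0 <= n%:R / q ^+ L n by rewrite divr_ge0// ltW.
  apply: ler_pM.
  - exact: mulr_ge0 (ler0n _ _) (mulr_ge0 (normr_ge0 _) c0).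
  - exact: mulr_ge0 nq0 (exprn_ge0 _ (d0 n)).
  - by rewrite ler_wpM2l// ler_wpM2r.
  rewrite -[leRHS]mul1r; apply: ler_pM.
  - by rewrite mulr_ge0// invr_ge0 ltW.
  - by rewrite exprn_ge0.
  - by rewrite ler_pdivrMr// mul1r Lq.
  - rewrite expr2 -[leRHS]mulr1; apply: ler_pM => //.
    exact: le_trans (dx n) x1.
have H2 : n%:R * d n * (`|t| * x n) ^+ p <= K ^+ p * (n%:R * x n ^+ p.+1).
  rewrite exprMn exprS.
  have -> : n%:R * d n * (`|t| ^+ p * x n ^+ p) =
    (`|t| ^+ p) * (n%:R * (d n * x n ^+ p)) by ring.
  apply: ler_pM; rewrite ?mulr_ge0 ?exprn_ge0//.
    by rewrite lerXn2r ?nnegrE.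
  by rewrite ler_wpM2l// ler_wpM2r// exprn_ge0.
have H3 : n%:R * d n * (`|t| * d n) ^+ 3 <= K ^+ 3 * (n%:R * x n ^+ p.+1).
  have -> : n%:R * d n * (`|t| * d n) ^+ 3 = `|t| ^+ 3 * (n%:R * d n ^+ 4) by ring.
  apply: ler_pM; rewrite ?mulr_ge0 ?exprn_ge0//.
    by rewrite lerXn2r ?nnegrE.
  rewrite ler_wpM2l//; apply: (@le_trans _ _ (x n ^+ 4)).
    by rewrite lerXn2r ?nnegrE.
  by rewrite ler_wiXn2l.
have -> : forall a b f : R, n%:R * d n * (2 * (a + b) + f) =
  2 * (n%:R * d n * a) + 2 * (n%:R * d n * b) + n%:R * d n * f by move=> *; ring.
have -> : M1 * x n + M2 * (n%:R * x n ^+ p.+1) =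
    2 * (p%:R * (K * c) * x n) + 2 * (K ^+ p * (n%:R * x n ^+ p.+1))
    + K ^+ 3 * (n%:R * x n ^+ p.+1) by rewrite /M1 /M2; ring.
apply: lerD => //; apply: lerD; rewrite ler_wpM2l//.
Unshelve. all: by end_near. Qed.

(** * The characteristic function of a lacunary sum *)

Lemma expectation_unit_lebesgue {R : realType} (f : R -> R) : continuous f ->
  (forall x, `|f x| <= 1) ->
  fine ('E_(@unit_lebesgue R)[f])%E = mean f.
Proof.
move=> cf f1; rewrite unlock /mean /Rintegral; congr fine.
have mf : measurable_fun setT f by exact: continuous_measurable_fun.
pose I : set (measurableTypeR R) := `[0, 1]%classic.
have mI : measurable I by exact: measurable_itv.
have intf : (@unit_lebesgue R).-integrable [set: measurableTypeR R] (EFin \o f).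
  apply: measurable_bounded_integrable => //.
    by have /= -> := @probability_setT _ _ _ (@unit_lebesgue R); rewrite ltry.
  exists 1; split; first exact: num_real.
  by move=> M M1 x _; apply: le_trans (f1 x) _; exact: ltW.
have I0 : unit_lebesgue (~` I) = 0%E :> \bar R.
  by rewrite /unit_lebesgue /mrestr setICl measure0.
have := negligible_integral (measurableC mI) measurableT intf I0.
rewrite setTD setCK => ->; apply: eq_measure_integral => A mA AI.
rewrite /= /unit_lebesgue /mrestr; congr (lebesgue_measure _).
by apply/seteqP; split=> [x []|x Ax]//; split => //; exact: AI.
Qed.

Lemma max_coef_ge0 {R : realType} (a : nat -> nat -> R) n : 0 <= max_coef a n.
Proof. exact: bigmax_ge_id. Qed.

Lemma le_max_coef {R : realType} (a : nat -> nat -> R) n k :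
  (1 <= k <= n)%N -> `|a k n| <= max_coef a n.
Proof.
move=> kn; apply: (le_bigmax_seq _ _ _ (fun k => `|a k n|)) => //.
by rewrite mem_index_iota ltnS.
Qed.

Lemma norm_seq_ge0 {R : realType} (a : nat -> nat -> R) n : 0 <= norm_seq a n.
Proof. exact: sqrtr_ge0. Qed.

Lemma sqr_norm_seq {R : realType} (a : nat -> nat -> R) n :
  norm_seq a n ^+ 2 = 2^-1 * \sum_(1 <= k < n.+1) a k n ^+ 2.
Proof.
by rewrite sqr_sqrtr// mulr_ge0// sumr_ge0// => k _; rewrite sqr_ge0.
Qed.

Lemma norm_seq_le {R : realType} (a : nat -> nat -> R) n :
  norm_seq a n <= Num.sqrt n%:R * max_coef a n.
Proof.
have d0 := max_coef_ge0 a n.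
rewrite -ler_sqr ?nnegrE ?mulr_ge0 ?norm_seq_ge0 ?sqrtr_ge0//.
rewrite sqr_norm_seq exprMn sqr_sqrtr ?ler0n//.
have : \sum_(1 <= k < n.+1) a k n ^+ 2 <= n%:R * max_coef a n ^+ 2.
  apply: (@le_trans _ _ (\sum_(1 <= k < n.+1) max_coef a n ^+ 2)).
    apply: ler_sum_nat => k kn.
    rewrite -(real_normK (num_real (a k n))) lerXn2r ?nnegrE//.
    exact: le_max_coef.
  by rewrite sumr_const_nat subn1 -[leLHS]mulr_natl.
have : 0 <= n%:R * max_coef a n ^+ 2 by rewrite mulr_ge0// exprn_ge0.
lra.
Qed.

(** The imaginary part is the real one with the phase [- pi / 2]. *)
Lemma char_fun_trig_var {R : realType} m (a : nat -> nat -> R) n (t : R) :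
  char_fun (trig_var m a n) t =
  Complex (mean (fun x => cos (t * cos_sum m (a^~ n) 1 n.+1 x + 0)))
          (mean (fun x => cos (t * cos_sum m (a^~ n) 1 n.+1 x + - (pi / 2)))).
Proof.
have cS := @continuous_cos_sum R m (a^~ n) 1 n.+1.
have c0 c : continuous (fun x => cos (t * cos_sum m (a^~ n) 1 n.+1 x + c)).
  exact: continuous_cosD.
have b0 c x : `|cos (t * cos_sum m (a^~ n) 1 n.+1 x + c)| <= 1.
  exact: normr_cos_le1.
rewrite /char_fun; congr Complex.
  by rewrite -expectation_unit_lebesgue//; do 3 f_equal; apply/funext => w;
    rewrite addr0.
rewrite -expectation_unit_lebesgue//; do 3 f_equal; apply/funext => w.
by rewrite cosB cos_pihalf sin_pihalf mulr0 mulr1 add0r.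
Qed.

Lemma normc_le {R : realType} (x y : R) :
  ComplexField.Normc.normc (Complex x y) <= `|x| + `|y|.
Proof.
rewrite /= -ler_sqr ?nnegrE ?addr_ge0 ?sqrtr_ge0//.
rewrite sqr_sqrtr ?addr_ge0 ?sqr_ge0// sqrrD !real_normK ?num_real//.
by rewrite lerD2r lerDl mulrn_wge0// mulr_ge0.
Qed.

Lemma prod_gauss_bounds {R : realType} (a : nat -> nat -> R) n (t : R) :
  `|t| * max_coef a n <= 1 ->
  let P := \prod_(1 <= k < n.+1) (1 - (t * a k n) ^+ 2 / 4) in
  let G := expR (- ((t * norm_seq a n) ^+ 2 / 2)) in
  [/\ 0 <= P, P <= G & G - P <= n%:R * (`|t| * max_coef a n) ^+ 4 / 16].
Proof.
move=> td P G; set d := max_coef a n in td *.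
have d0 : 0 <= d := max_coef_ge0 a n.
pose x k := (t * a k n) ^+ 2 / 4.
have xd k : (1 <= k < n.+1)%N -> 0 <= x k <= (`|t| * d) ^+ 2 / 4.
  move=> kn; rewrite divr_ge0 ?sqr_ge0//= ler_wpM2r//.
  rewrite -(real_normK (num_real (t * _))) lerXn2r ?nnegrE ?mulr_ge0//.
  by rewrite normrM ler_wpM2l// le_max_coef.
have td2 : (`|t| * d) ^+ 2 <= 1 by rewrite exprn_ile1// mulr_ge0.
have x01 : {in index_iota 1 n.+1, forall k, 0 <= x k <= 1}.
  move=> k; rewrite mem_index_iota => /xd /andP[-> /= /le_trans]; apply.
  lra.
have GE : G = expR (- \sum_(1 <= k < n.+1) x k).
  congr (expR (- _)); rewrite exprMn sqr_norm_seq -mulr_suml.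
  under [in RHS]eq_bigr do rewrite exprMn.
  by rewrite -mulr_sumr; field.
have [/andP[P0 PG] GP] := prod_1B_bounds _ _ _ x01.
rewrite GE; split => //; apply: le_trans GP _.
apply: (@le_trans _ _ (\sum_(1 <= k < n.+1) ((`|t| * d) ^+ 2 / 4) ^+ 2)).
  by apply: ler_sum_nat => k /xd /andP[x0 xk]; rewrite lerXn2r ?nnegrE// (le_trans x0).
rewrite sumr_const_nat subn1 -[leLHS]mulr_natl -mulrA ler_wpM2l//.
by rewrite le_eqVlt; apply/orP; left; apply/eqP; field.
Qed.

(** The absolute error is [2 sqrt n * eta] with [sqrt n * eta <= e / A_n], because
[A_n <= sqrt n * d_n].  The factor [1 / A_n] is kept in the last bound: it is
what makes the error integrable over [|l| <= A_n K]. *)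
Lemma char_fun_approx {R : realType} (q : R) m (a : nat -> nat -> R)
    (p n L : nat) (t e : R) :
  1 < q -> lacunary q m -> p.-1%:R < q -> (forall k, (1 <= k)%N -> (0 < m k)%N) ->
  (0 < L)%N -> `|t| * (L%:R * max_coef a n) <= 1 ->
  1 <= norm_seq a n ->
  n%:R * max_coef a n *
    (2 * osc_bound q p L (max_coef a n) t + (`|t| * max_coef a n) ^+ 3) <= e ->
  let G := expR (- ((t * norm_seq a n) ^+ 2 / 2)) in
  exists x y : R, [/\ char_fun (trig_var m a n) t = Complex x y,
    `|x - G| <= 2 * e + `|t| * e,
    `|y| <= 2 * e &
    `|x| + `|y| <= G + 4 * e / norm_seq a n].
Proof.
move=> q1 mq pq m0 L0 tLd A1; set d := max_coef a n in tLd *.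
set A := norm_seq a n in A1 *; set eta := 2 * _ + _ => etae G.
have d0 : 0 <= d := max_coef_ge0 a n.
have td : `|t| * d <= 1.
  apply: le_trans tLd; rewrite ler_wpM2l//.
  by rewrite -[leLHS]mul1r ler_wpM2r// ler1n.
have osc0 : 0 <= osc_bound q p L d t by exact: osc_bound_ge0.
have td0 : 0 <= `|t| * d by rewrite mulr_ge0.
have eta0 : 0 <= eta.
  by apply: addr_ge0; [exact: mulr_ge0|exact: exprn_ge0].
have A0 : 0 < A by apply: lt_le_trans A1.
have nn : Num.sqrt n%:R * Num.sqrt n%:R = n%:R :> R.
  by rewrite -expr2 sqr_sqrtr ?ler0n.
have se : Num.sqrt n%:R * eta <= e / A.
  rewrite ler_pdivlMr//; apply: le_trans etae; rewrite mulrAC ler_wpM2r//.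
  by rewrite -[X in _ <= X * _]nn -mulrA ler_wpM2l ?sqrtr_ge0// norm_seq_le.
have eA : e / A <= e.
  rewrite ler_pdivrMr//; apply: ler_peMr => //.
  by apply: le_trans etae; apply: mulr_ge0 => //; exact: mulr_ge0.
have bd l : (1 <= l <= n)%N -> `|a l n| <= d by exact: le_max_coef.
have [P0 PG GP] := prod_gauss_bounds _ _ _ td; rewrite -/G in PG GP.
set P := \prod_(_ <= _ < _) _ in P0 PG GP.
have H c : `|mean (fun x => cos (t * cos_sum m (a^~ n) 1 n.+1 x + c))
     - cos c * P| <= 2 * (e / A).
  apply: le_trans (_ : _ <= 2 * (Num.sqrt n%:R * eta)) _; last by rewrite ler_wpM2l.
  by rewrite mulrA; apply: mean_cos_lacunary_le.
have := H 0; have := H (- (pi / 2)).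
rewrite cosN cos_pihalf cos0 mul0r mul1r subr0.
rewrite char_fun_trig_var; set y := mean _; set x := mean _ => Hy Hx.
(* The quartic error of the product is [|t|] times the cubic term of [eta]. *)
have GP2 : G - P <= `|t| * e.
  apply: le_trans GP _.
  have -> : n%:R * (`|t| * d) ^+ 4 / 16 = `|t| * (n%:R * d * (`|t| * d) ^+ 3 / 16) by ring.
  rewrite ler_wpM2l//; apply: le_trans etae.
  have h0 : 0 <= n%:R * d by rewrite mulr_ge0.
  rewrite -[leLHS]mulrA ler_wpM2l// /eta.
  have := exprn_ge0 3 td0; lra.
exists x, y; split => //.
- have -> : x - G = (x - P) - (G - P) by ring.
  apply: le_trans (ler_normB _ _) _; apply: lerD; first lra.
  by rewrite ger0_norm// subr_ge0.
- lra.
- have : `|x| <= `|x - P| + P.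
    by rewrite -[X in _ + X](ger0_norm P0) -[X in `|X| <= _](subrK P x) ler_normD.
  lra.
Qed.

Lemma cvg_complex0 {R : realType} (f : nat -> R[i]) (x : R) :
  (forall e : R, 0 < e -> \forall n \near \oo, exists u v : R,
     [/\ f n = Complex u v, `|u - x| <= e & `|v| <= e]) ->
  f n @[n --> \oo] --> (Complex x 0 : R[i]^o).
Proof.
move=> H; apply/(@cvgrPdist_lt R[i] R[i]^o) => [[e e']]; rewrite ltcE/= => /andP[/eqP -> e0].
have e40 : 0 < e / 4 by rewrite divr_gt0.
have := H _ e40; apply: filterS => n [u [v [-> ux v0]]].
rewrite normc_def ltcE/= eqxx/=.
have -> : (x - u) ^+ 2 + (0 - v) ^+ 2 = (x - u) ^+ 2 + v ^+ 2 by ring.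
have := normc_le (x - u) v => /= /le_lt_trans; apply.
by rewrite distrC; lra.
Qed.

(** * Integrals over the tails *)

(** The integral of a nonnegative function is the supremum of the integrals of
the simple functions below it, which is monotone in the function. *)
Lemma le_integral_nonneg {d} {T : measurableType d} {R : realType}
    (mu : {measure set T -> \bar R}) (D : set T) (f g : T -> \bar R) :
  (forall x, D x -> 0 <= f x)%E -> (forall x, D x -> f x <= g x)%E ->
  (\int[mu]_(x in D) f x <= \int[mu]_(x in D) g x)%E.
Proof.
move=> f0 fg; rewrite !ge0_integralE//; last first.
  by move=> x Dx; exact: le_trans (f0 x Dx) (fg x Dx).
apply: le_ereal_sup => _ [h hf <-]; exists h => // x.
apply: le_trans (hf x) _; rewrite /patch; case: ifPn => //.
by rewrite inE => /fg.
Qed.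

Lemma measurable_invsq {R : realType} (D : set R) :
  measurable_fun D (fun x : R => ((x ^+ 2)^-1)%:E).
Proof.
apply/measurable_EFinP; apply: measurable_funTS.
have -> : (fun x : R => (x ^+ 2)^-1) = (@powR R ^~ (-1)) \o (fun x => x ^+ 2).
  by apply/funext => x /=; rewrite powR_inv1// sqr_ge0.
by apply: measurableT_comp; [exact: measurable_powR|exact: exprn_measurable].
Qed.

Lemma integral_invsq_itvcy {R : realType} (a : R) : 0 < a ->
  (\int[@lebesgue_measure R]_(x in `[a, +oo[) ((x ^+ 2)^-1)%:E = (a^-1)%:E)%E.
Proof.
move=> a0.
have dF (x : R) : 0 < x -> is_derive x 1 (fun x => - x^-1) ((x ^+ 2)^-1).
  move=> x0; have xn0 : x != 0 by rewrite gt_eqF.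
  have H : is_derive x 1 (fun x => (id x)^-1) _ := is_deriveV xn0 (is_derive_id _ _).
  have -> : (fun x : R => - x^-1) = - (fun x => (id x)^-1) by [].
  apply: (is_derive_eq (is_deriveN H)).
  by rewrite /GRing.scale/= mulr1 opprK.
rewrite (@ge0_continuous_FTC2y _ _ (fun x => - x^-1) a 0)//.
- by rewrite sub0e -EFinN opprK.
- by move=> x ax; rewrite invr_ge0 sqr_ge0.
- apply: continuous_in_subspaceT => x.
  rewrite inE/= in_itv/= andbT => ax.
  apply: cvgV; first by rewrite expf_eq0/= gt_eqF// (lt_le_trans a0).
  by rewrite expr2; under eq_fun do rewrite expr2; apply: cvgM; exact: cvg_id.
- rewrite -[X in _ --> X]oppr0; apply: cvgN.
  apply/gtr0_cvgV0; first by exists 0; split => // x x0.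
  exact: cvg_id.
- by move=> x ax; case: (dF x (lt_trans a0 ax)).
- apply: cvg_at_right_filter; apply: cvgN; apply: cvgV; last exact: cvg_id.
  by rewrite gt_eqF.
- move=> x; rewrite in_itv/= andbT => ax; rewrite derive1E.
  by case: (dF x (lt_trans a0 ax)).
Qed.

Lemma integral_invsq_tail {R : realType} (a : R) : 0 < a ->
  (\int[@lebesgue_measure R]_(x in [set x : R | (a <= `|x|)%R]) ((x ^+ 2)^-1)%:E
    = (2 * a^-1)%:E)%E.
Proof.
move=> a0.
have -> : [set x : R | a <= `|x|] = (`]-oo, -a] `|` `[a, +oo[)%classic.
  apply/seteqP; split=> x /=; rewrite !in_itv/= andbT ler_normr lerNr.
    by move=> /orP[]; [right|left].
  by move=> [->|->]; rewrite ?orbT.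
rewrite ge0_integral_setU//=.
- rewrite ge0_integration_by_substitutionNy//.
  + have -> : ((fun x : R => (x ^+ 2)^-1) \o -%R) = (fun x => (x ^+ 2)^-1).
      by apply/funext => x /=; rewrite sqrrN.
    by rewrite integral_invsq_itvcy// -EFinD; congr EFin; ring.
  + apply: continuous_in_subspaceT => x.
    rewrite inE/= in_itv/= => xa.
    apply: cvgV; first by rewrite expf_eq0/= lt_eqF// (le_lt_trans xa)// oppr_lt0.
    by rewrite expr2; under eq_fun do rewrite expr2; apply: cvgM; exact: cvg_id.
  + by move=> x _; rewrite invr_ge0 sqr_ge0.
- exact: measurable_invsq.
- by move=> x _; rewrite lee_fin invr_ge0 sqr_ge0.
- apply/disj_setPS => x /= []; rewrite !in_itv/= andbT => xa ax.
  by lra.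
Qed.

Lemma expR_gauss_le {R : realType} (l : R) : l != 0 ->
  expR (- (l ^+ 2 / 2)) <= 2 * (l ^+ 2)^-1.
Proof.
move=> l0; have l2 : 0 < l ^+ 2 by rewrite exprn_even_gt0.
have -> : 2 * (l ^+ 2)^-1 = (l ^+ 2 / 2)^-1 by field.
rewrite expRN lef_pV2 ?posrE ?expR_gt0 ?divr_gt0//.
by apply: le_trans (expR_ge1Dx _); rewrite lerDr.
Qed.

(** The Gaussian is replaced by [2 / l ^ 2], whose primitive is explicit. *)
Lemma gauss_tail_integral_le {R : realType} (f : R -> R) (a M delta : R) :
  0 < a -> 0 <= M -> 0 <= delta -> (forall l, 0 <= f l) ->
  (forall l, `|l| <= M -> f l <= expR (- (l ^+ 2 / 2)) + delta) ->
  (\int[@lebesgue_measure R]_(l in [set l : R | (a <= `|l|)%R])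
      (f l * \1_[set l : R | `|l| <= M] l)%:E
    <= (4 / a + delta * (2 * M))%:E)%E.
Proof.
move=> a0 M0 delta0 f0 fM.
set D := [set l : R | _]; set I := [set l : R | _].
have IE : I = `[- M, M]%classic.
  by apply/seteqP; split => l; rewrite /I/= in_itv/= ler_norml.
have mI : measurable (I : set (measurableTypeR R)).
  by rewrite IE; exact: measurable_itv.
have mD : measurable (D : set (measurableTypeR R)).
  have -> : D = ~` `]-a, a[%classic; last by apply: measurableC; exact: measurable_itv.
  apply/seteqP; split => l; rewrite /D/= in_itv/= -ltr_norml.
    by move=> al; apply/negP; rewrite -leNgt.
  by move/negP; rewrite -leNgt.
apply: (@le_trans _ _ (\int[@lebesgue_measure R]_(l in D)
   (2%:E * ((l ^+ 2)^-1)%:E + delta%:E * (\1_I l)%:E)))%E.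
  apply: le_integral_nonneg => l; rewrite /D/= => al.
    by rewrite lee_fin mulr_ge0.
  rewrite -!EFinM -EFinD lee_fin indicE.
  have l0 : l != 0.
    by apply: contraTneq al => ->; rewrite normr0 -ltNge.
  have [|_] := boolP (l \in I); last by rewrite !mulr0 addr0 mulr_ge0// invr_ge0 sqr_ge0.
  rewrite inE => lI; rewrite !mulr1; apply: le_trans (fM l lI) _.
  by rewrite lerD2r expR_gauss_le.
have minv := measurable_invsq D.
have mind : measurable_fun D (fun l : R => (\1_I l)%:E : \bar R).
  by apply/measurable_EFinP; exact: measurable_indic.
rewrite ge0_integralD//=; last 4 first.
- by move=> l _; rewrite -EFinM lee_fin mulr_ge0// invr_ge0 sqr_ge0.
- by apply: measurable_funeM.
- by move=> l _; rewrite -EFinM lee_fin mulr_ge0.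
- by apply: measurable_funeM.
rewrite ge0_integralZl//=; last first.
  by move=> l _; rewrite lee_fin invr_ge0 sqr_ge0.
rewrite ge0_integralZl//=.
rewrite integral_invsq_tail// integral_indic// -EFinM.
have -> : 2 * (2 / a) = 4 / a by ring.
rewrite [leRHS]EFinD; apply: leeD2l; rewrite [leRHS]EFinM; apply: lee_wpmul2l; first by rewrite lee_fin.
apply: (@le_trans _ _ (lebesgue_measure I)).
  apply: le_measure; rewrite ?inE//; first exact: measurableI.
rewrite IE lebesgue_measure_itv/= lte_fin.
case: ifPn => _; last by rewrite lee_fin mulr_ge0.
by rewrite -EFinB lee_fin opprK mulr_natl.
Qed.

Lemma cvge0_squeeze {R : realType} (g : R -> \bar R) :
  (forall e : R, 0 < e -> \forall a \near +oo, (0 <= g a <= e%:E)%E) ->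
  g a @[a --> +oo] --> 0%E.
Proof.
move=> H; apply/fine_cvgP; split.
  have := H 1 ltr01; apply: filterS => a /andP[g0 g1].
  by rewrite ge0_fin_numE// (le_lt_trans g1)// ltry.
apply/cvgr0Pnorm_le => e e0; have := H e e0; apply: filterS => a /andP[g0 ge].
have gf : g a \is a fin_num by rewrite ge0_fin_numE// (le_lt_trans ge)// ltry.
by rewrite /= ger0_norm ?fine_ge0// -lee_fin fineK.
Qed.

(** * Weak mod-Gaussian convergence *)

(** For the uniform integrability, the rows [n >= N] are covered by the comparison
with the Gaussian, and for the finitely many others the integrand vanishes as soon
as the threshold exceeds [A_n K]. *)
Lemma weak_mod_gaussian_lacunary {R : realType} (q : R) (m : nat -> nat)
    (a : nat -> nat -> R) (p : nat) (eps : R) :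
  1 < q -> lacunary q m -> (forall k, (1 <= k)%N -> (0 < m k)%N) ->
  p.-1%:R < q -> (p <= 3)%N -> 0 < eps ->
  norm_seq a n @[n --> \oo] --> +oo ->
  n%:R `^ (1 + eps) * max_coef a n ^+ p.+1 @[n --> \oo] --> (0 : R) ->
  weak_mod_gaussian (trig_var m a) (norm_seq a).
Proof.
move=> q1 mq m0 pq p3 eps0 Ay dcvg.
have d0 := max_coef_ge0 a.
have [L [L0 Lq Lcvg]] := log_window _ _ _ _ q1 eps0 d0 dcvg.
have approx K e : 0 <= K -> 0 < e -> \forall n \near \oo,
    1 <= norm_seq a n /\ forall t, `|t| <= K ->
  let G := expR (- ((t * norm_seq a n) ^+ 2 / 2)) in
  exists x y : R, [/\ char_fun (trig_var m a n) t = Complex x y,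
    `|x - G| <= 2 * e + `|t| * e,
    `|y| <= 2 * e &
    `|x| + `|y| <= G + 4 * e / norm_seq a n].
  move=> K0 e0.
  have H := osc_remainder_cvg _ _ _ _ _ q1 pq p3 d0 K0 L0 Lq Lcvg e e0.
  near=> n.
  have A1 : 1 <= norm_seq a n by near: n; move/cvgryPge : Ay; exact.
  have Hn : forall t, `|t| <= K -> `|t| * ((L n)%:R * max_coef a n) <= 1 /\
    n%:R * max_coef a n * (2 * osc_bound q p (L n) (max_coef a n) t
      + (`|t| * max_coef a n) ^+ 3) <= e.
    by near: n.
  split => // t /Hn [tL te].
  exact: (@char_fun_approx _ q _ _ p _ (L n)).
split => //.
- move=> l; apply: cvg_complex0 => e e0.
  have e'0 : 0 < e / (2 + `|l|) by rewrite divr_gt0// ltr_wpDr.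
  have := approx `|l| _ (normr_ge0 l) e'0; apply: filterS => n [A1 Hn].
  have A0 : 0 < norm_seq a n by apply: lt_le_trans A1.
  have lA : `|l / norm_seq a n| <= `|l|.
    rewrite normrM normfV (gtr0_norm A0) ler_pdivrMr//.
    by rewrite ler_peMr.
  have [x [y [-> xG y0 _]]] := Hn _ lA; exists x, y; move: xG.
  rewrite divfK ?gt_eqF// => xG.
  have le : 2 * (e / (2 + `|l|)) + `|l| * (e / (2 + `|l|)) = e.
    by rewrite -mulrDl mulrC divfK// gt_eqF// ltr_wpDr.
  split => //.
    apply: le_trans xG _; rewrite -[leRHS]le lerD2l ler_wpM2r// ltW//.
  by apply: le_trans y0 _; rewrite -[leRHS]le lerDl mulr_ge0// ltW.
- move=> K K0; apply: cvge0_squeeze => e e0.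
  (* The two contributions to the tail are [4 / b] and [8 * K * e']. *)
  pose e' := e / (2 * (8 * K + 1)).
  have K80 : 0 < 8 * K + 1 by rewrite ltr_wpDl ?mulr_ge0.
  have e'0 : 0 < e' by rewrite divr_gt0// mulr_gt0.
  have [N _ HN] := approx K e' K0 e'0.
  have B_ge n : (n < N)%N -> norm_seq a n * K <= \sum_(i < N) norm_seq a i * K.
    move=> nN; rewrite (bigD1 (Ordinal nN))//= lerDl sumr_ge0// => i _.
    by rewrite mulr_ge0// norm_seq_ge0.
  near=> b.
  have b0 : 0 < b by near: b; apply: nbhs_pinfty_gt; exact: num_real.
  have be : 4 / b <= e / 2.
    by rewrite ler_pdivrMr// -ler_pdivrMl ?divr_gt0//.
  have bB : \sum_(i < N) norm_seq a i * K < b.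
    by near: b; apply: nbhs_pinfty_gt; exact: num_real.
  pose F n l := ComplexField.Normc.normc (char_fun (trig_var m a n) (l / norm_seq a n)).
  have F0 n l : 0 <= F n l.
    by rewrite /F; case: (char_fun _ _) => x y; exact: sqrtr_ge0.
  apply/andP; split.
    apply: ereal_sup_ge; eexists; first by exists 0%N.
    apply: integral_ge0 => l _; rewrite lee_fin mulr_ge0//.
    exact: F0.
  apply: ge_ereal_sup => _ [n _ <-].
  have [nN|Nn] := ltnP n N.
    rewrite integral0_eq ?lee_fin ?ltW// => l /= bl.
    rewrite indicE memNset ?mulr0//= => lA.
    have := lt_le_trans (le_lt_trans (B_ge _ nN) bB) bl.
    by rewrite ltNge lA.
  have [A1 Hn] := HN n Nn.
  have A0 : 0 < norm_seq a n by apply: lt_le_trans A1.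
  apply: le_trans (gauss_tail_integral_le (F n) b (norm_seq a n * K)
    (4 * e' / norm_seq a n) b0 _ _ (F0 n) _) _.
  - by rewrite mulr_ge0// ltW.
  - by apply: divr_ge0; [apply: mulr_ge0 => //; exact: ltW|exact: ltW].
  - move=> l lAK.
    have lK : `|l / norm_seq a n| <= K.
      by rewrite normrM normfV (gtr0_norm A0) ler_pdivrMr// mulrC.
    have [x [y [E _ _ xy]]] := Hn _ lK.
    rewrite /F E; apply: le_trans (normc_le _ _) _.
    by move: xy; rewrite divfK ?gt_eqF.
  rewrite lee_fin.
  have -> : 4 * e' / norm_seq a n * (2 * (norm_seq a n * K)) = 8 * K * e'.
    by field; rewrite gt_eqF.
  have : 8 * K * e' <= e / 2.
    rewrite /e' mulrA ler_pdivrMr ?mulr_gt0//.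
    have -> : e / 2 * (2 * (8 * K + 1)) = 8 * K * e + e by field.
    by rewrite lerDl ltW.
  lra.
Unshelve. all: by end_near. Qed.

Theorem theorem2p1 (R : realType) (q : R) (m : nat -> nat)
    (a : nat -> nat -> R)
    (q_gt1 : 1 < q)
    (m_gt0 : forall k : nat, (1 <= k)%N -> (0 < m k)%N)
    (m_incr : forall k : nat, (1 <= k)%N -> (m k < m k.+1)%N)
    (m_gap : forall k : nat, (1 <= k)%N -> q <= (m k.+1)%:R / (m k)%:R)
    (A_infty : norm_seq a n @[n --> \oo] --> +oo)
    (d_small : exists2 eps : R, 0 < eps &
       (q <= 2 ->
          n%:R `^ (1 + eps) * max_coef a n ^+ 3 @[n --> \oo] --> (0 : R))
       /\ (2 < q ->
          n%:R `^ (1 + eps) * max_coef a n ^+ 4 @[n --> \oo] --> (0 : R))) :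
  weak_mod_gaussian (trig_var m a) (norm_seq a).
Proof.
have mq : lacunary q m.
  by move=> k k1; have := m_gap k k1; rewrite ler_pdivlMr// ltr0n m_gt0.
have [eps eps0 [small2 small3]] := d_small.
have [q2|q2] := leP q 2.
  exact: (@weak_mod_gaussian_lacunary _ q _ _ 2 eps) (small2 q2).
exact: (@weak_mod_gaussian_lacunary _ q _ _ 3 eps) (small3 q2).
Qed.
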